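(* Let $d\ge 3$ be an integer, $\mathbb F_d=\mathbb Q(\cos^2(\pi/d))\subset\mathbb R$, and let $\alpha$ be a totally real algebraic integer (a real number), $\mathbb K=\mathbb F_d(\alpha)$, such that $4<\alpha<16^2$ and $0<\sigma(\alpha)<\sigma(4\sin^2(\pi/d))$ for every field embedding $\sigma:\mathbb K\to\mathbb R$ other than the identity inclusion. Then $\mathbb K=\mathbb Q(\alpha)$, and such $\alpha$ can exist only for the values of $d$ listed below, with $m=[\mathbb K:\mathbb F_d]$ bounded as follows: $d=3$: $m\le47$; $d=4$: $m\le16$; $d=5$: $m\le10$; $d=6$: $m\le8$; $d=7$: $m\le10$; $d=8$: $m\le9$; $d=9$: $m\le5$; $d=10$: $m\le5$; $d=11$: $m\le4$; $d=12$: $m\le5$; $d=13$: $m\le3$; $d=14$: $m\le3$; $d=15$: $m\le2$; $d=16$: $m\le3$; $d=17$: $m\le2$; $d=18$: $m\le4$; $d=19$: $m\le2$; $d=20$: $m\le3$; $d=21$: $m\le2$; $d=22$: $m\le2$; $d=24$: $m\le3$; $d=26$: $m\le2$; $d=28$: $m\le2$; $d=30$: $m\le3$; $d=36$: $m\le2$; $d=42$: $m\le2$; and for $d\in\{23,25,27,29,31,32,33,34,35,38,39,40,44,45,46,48,50,52,54,56,58,60,62,64,66,70,72,78,80,84,90,96,102,120\}$ one has $m=1$, i.e. $\mathbb K=\mathbb F_d$. In particular $[\mathbb K:\mathbb Q]\le47$ for $d=3$, $[\mathbb K:\mathbb Q]\le30$ for $d=7$, $[\mathbb K:\mathbb Q]\le20$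 for $d=5,11$, $[\mathbb K:\mathbb Q]\le18$ for $d=8,13,19$, and $[\mathbb K:\mathbb Q]\le16$ for all remaining $d$.
   Context: All fields are regarded as subfields of $\mathbb R$; ''the identity inclusion'' is the given embedding $\mathbb K\subset\mathbb R$. *)

(* Defs.v *)
From HB Require Import structures.
From mathcomp Require Import all_boot all_order all_algebra all_field.
Set Implicit Arguments. Unset Strict Implicit. Unset Printing Implicit Defensive.
Import Order.TTheory GRing.Theory Num.Theory.
Local Open Scope ring_scope.

(* cos(pi/d) inside the algebraic complex numbers: d.-root (-1) is the d-th
   root of -1 with nonnegative imaginary part and maximal real part, i.e.
   exp(i pi / d) (for d >= 1); its real part is cos(pi/d). *)
Definition cospi (d : nat) : algC := 'Re (d.-root (-1)).

(* Table of the theorem: pairs (d, bound on m = [K : F_d]). *)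
Definition bound_table : seq (nat * nat) :=
  [:: (3,47); (4,16); (5,10); (6,8); (7,10); (8,9); (9,5); (10,5); (11,4);
      (12,5); (13,3); (14,3); (15,2); (16,3); (17,2); (18,4); (19,2); (20,3);
      (21,2); (22,2); (24,3); (26,2); (28,2); (30,3); (36,2); (42,2)]%N
  ++ [seq (d, 1%N) | d <- [:: 23; 25; 27; 29; 31; 32; 33; 34; 35; 38; 39; 40;
        44; 45; 46; 48; 50; 52; 54; 56; 58; 60; 62; 64; 66; 70; 72; 78; 80;
        84; 90; 96; 102; 120]%N].

Definition abs_degree_bound (d : nat) : nat :=
  if d == 3 then 47
  else if d == 7 then 30
  else if (d == 5) || (d == 11) then 20
  else if (d == 8) || (d == 13) || (d == 19) then 18
  else 16.

(* Main.v *)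
Require Import Defs.
From Stdlib Require Import NArith.
From HB Require Import structures.
From mathcomp Require Import all_boot all_order all_algebra all_field.
From mathcomp Require Import zify ring lra.
Import Order.TTheory GRing.Theory Num.Theory.
Local Open Scope ring_scope.
Set Implicit Arguments.
Unset Strict Implicit.
Unset Printing Implicit Defensive.

(** Put b = 4 sin^2(pi/d), y = alpha/b and t = y (1 - y), so that 0 < t <= 1/4
    at every embedding but the identity. If Q is an integral polynomial of small
    sup norm on [0, 1/4], then Q(t), multiplied by a suitable power of b, is a
    nonzero algebraic integer, so its norm is at least 1 in absolute value; as
    alpha < 256 controls the factor at the identity, this bounds [K : Q]. The
    power of b contributes N(b) = g^m, where N_(F_d/Q)(b) = g is the value of
    the d-th cyclotomic polynomial at 1: p if d is a power of the prime p, and 1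
    otherwise. The choice Q = t^4 (1 - 4t), with sup norm 5^-5, settles all d
    except 3, 4, 5 and 7, for which Q is a product of powers of t, 9t - 1 and
    9t - 2 (d = 3), of t and 1 - 4t (d = 4), of t and 5t - 1 (d = 5), of t,
    1 - 4t and 7t - 1 (d = 7). Finally K = Q(alpha) because alpha > 4 exceeds
    all its other conjugates, so it is a simple root of its characteristic
    polynomial, which is a power of its minimal polynomial. *)

Local Notation pQtoC := (map_poly (ratr : rat -> algC)).

(** * Rational polynomials with conjugate roots *)

Lemma minCpoly_root_eq (x y : algC) : root (minCpoly x) y -> minCpoly y = minCpoly x.
Proof.
have [p [Dp mon_p] dv_p] := minCpolyP x; have [q [Dq mon_q] dv_q] := minCpolyP y.
rewrite Dp dv_q => /dvdpP[s Ds]; rewrite Dq; congr pQtoC; apply/eqP.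
rewrite -eqp_monic //.
have : root (pQtoC s * pQtoC q) x by rewrite -rmorphM /= -Ds dv_p.
rewrite rootM !dv_p => /orP[ps|pq]; last by rewrite /eqp pq Ds dvdp_mull.
have s0 : s != 0.
  by apply: contraTneq mon_p => s0; rewrite Ds s0 mul0r monicE lead_coef0 eq_sym oner_eq0.
have := dvdp_leq s0 ps; rewrite Ds size_mul // ?monic_neq0 //.
have : (1 < size q)%N by rewrite -(size_map_poly (ratr : {rmorphism rat -> algC})) -Dq
  size_minCpoly.
by move: s0; rewrite -size_poly_eq0; move: (size q) (size s) => k l; lia.
Qed.

Lemma horner_minCpoly_root (x y : algC) (u v : {poly rat}) :
    root (minCpoly x) y -> (pQtoC u).[x] = (pQtoC v).[x] ->
  (pQtoC u).[y] = (pQtoC v).[y].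
Proof.
have [p [Dp _] dv_p] := minCpolyP x; rewrite Dp => py0 /eqP.
rewrite -subr_eq0 -hornerN -hornerD -rmorphB.
rewrite -[_ == 0]/(root (pQtoC (u - v)) x) dv_p => /dvdpP[s Ds].
apply/eqP; rewrite -subr_eq0 -hornerN -hornerD -rmorphB Ds rmorphM hornerM.
by rewrite (rootP py0) mulr0.
Qed.

Lemma separable_minCpoly (x : algC) : separable_poly (minCpoly x).
Proof.
have [p [Dp mon_p] dv_p] := minCpolyP x; rewrite Dp separable_map.
have p0 := monic_neq0 mon_p.
rewrite unlock; apply/coprimepP => d dv_dp dv_dp'.
have szp' : (size p^`() < size p)%N by rewrite lt_size_deriv.
have p'0 : p^`() != 0.
  have sz_p : (1 < size p)%N.
    by rewrite -(size_map_poly (ratr : {rmorphism rat -> algC})) -Dp size_minCpoly.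
  apply/eqP => /(congr1 (fun q : {poly rat} => q`_(size p).-2)) /eqP.
  rewrite coef_deriv coef0; have -> : (size p).-2.+1 = (size p).-1 by lia.
  by rewrite -lead_coefE (monicP mon_p) pnatr_eq0; lia.
have [s Ds] := dvdpP _ _ dv_dp.
have : root (pQtoC s * pQtoC d) x by rewrite -rmorphM /= -Ds dv_p.
have s0 : s != 0 by apply: contraNneq p0 => s0; rewrite Ds s0 mul0r.
have d0 : d != 0 by apply: contraNneq p0 => d0; rewrite Ds d0 mulr0.
rewrite rootM !dv_p => /orP[ps|pd]; last first.
  by have := leq_trans szp' (leq_trans (dvdp_leq d0 pd) (dvdp_leq p'0 dv_dp')); rewrite ltnn.
rewrite -size_poly_eq1 eqn_leq lt0n size_poly_eq0 d0 andbT.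
have := dvdp_leq s0 ps; rewrite Ds size_mul //.
by move: s0 d0; rewrite -!size_poly_eq0; move: (size d) (size s) => k l; lia.
Qed.

Lemma minCpoly_roots (x : algC) :
  {rs : seq algC | minCpoly x = \prod_(r <- rs) ('X - r%:P) & uniq rs}.
Proof.
have [rs Drs] := closed_field_poly_normal (minCpoly x).
rewrite (monicP (minCpoly_monic x)) scale1r in Drs.
exists rs => //; rewrite -separable_prod_XsubC -Drs; exact: separable_minCpoly.
Qed.

(* A splitting rational polynomial whose roots are all conjugate to x is a
   power of the minimal polynomial, whatever the multiplicities. *)
Lemma rat_poly_conj_power (x : algC) (P : {poly rat}) :
    P \is monic -> (forall y, root (pQtoC P) y -> root (minCpoly x) y) ->
  exists k, pQtoC P = minCpoly x ^+ k.
Proof.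
have [n] := ubnP (size P); elim: n P => // n IHn P le_Pn mon_P conj_P.
have [szP|szP] := leqP (size P) 1.
  exists 0%N; rewrite expr0 (size1_polyC szP) map_polyC /=.
  move: mon_P; rewrite monicE lead_coefE; have -> : (size P).-1 = 0%N.
    by case: (size P) szP => [|[]].
  by move/eqP->; rewrite rmorph1.
have /closed_rootP[y Py] : size (pQtoC P) != 1%N by rewrite size_map_poly;
  apply: contraTneq szP => ->.
have [p [Dp mon_p] dv_p] := minCpolyP y.
have Dx := minCpoly_root_eq (conj_P y Py); rewrite -Dx in conj_P *.
move: Py; rewrite dv_p => /dvdpP[Q DQ].
have mon_Q : Q \is monic by rewrite -(monicMr _ mon_p) -DQ.
have [||k Dk] := IHn Q _ mon_Q; last first.
- by exists k.+1; rewrite DQ rmorphM /= Dk -Dp ?Dx exprSr.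
- by move=> w Qw; rewrite -Dx; apply: conj_P; rewrite DQ rmorphM rootM Qw.
have sz_p : (1 < size p)%N.
  by rewrite -(size_map_poly (ratr : {rmorphism rat -> algC})) -Dp size_minCpoly.
rewrite -ltnS (leq_trans _ le_Pn) // DQ size_Mmonic ?monic_neq0 //.
by move: szP; rewrite DQ size_Mmonic ?monic_neq0 //; lia.
Qed.

(* Multiplication by q on Q[X]/(p) is diagonalised by the Vandermonde matrix
   of the roots of p. *)
Lemma prod_horner_rat (p q : {poly rat}) n (r : 'I_n -> algC) :
    pQtoC p = \prod_(i < n) ('X - (r i)%:P) -> injective r ->
  exists P : {poly rat}, P \is monic /\
    \prod_(i < n) ('X - (pQtoC q).[r i]%:P) = pQtoC P.
Proof.
move=> Dp inj_r.
have szp : size p = n.+1.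
  rewrite -(size_map_poly (ratr : {rmorphism rat -> algC})) Dp.
  have -> : \prod_(i < n) ('X - (r i)%:P) = \prod_(z <- [seq r i | i <- enum 'I_n]) ('X - z%:P).
    by rewrite big_map big_enum.
  by rewrite size_prod_XsubC size_map size_enum_ord.
have p0 : p != 0 by rewrite -size_poly_gt0 szp.
pose row (j : nat) := ('X^j * q) %% p.
have sz_row j : (size (row j) <= n)%N by rewrite -ltnS -szp ltn_modp.
pose A : 'M[rat]_n := \matrix_(j, k) (row j)`_k.
pose A' := map_mx (ratr : rat -> algC) A.
pose V : 'M[algC]_n := Vandermonde n (\row_i r i).
pose D : 'M[algC]_n := diag_mx (\row_i (pQtoC q).[r i]).
have root_r i : (pQtoC p).[r i] = 0.
  by rewrite Dp horner_prod (bigD1 i) //= !hornerE subrr mul0r.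
have AV : A' *m V = V *m D.
  apply/matrixP => j i; rewrite !mxE.
  transitivity ((pQtoC (row j)).[r i]).
    rewrite (horner_coef_wide _ (_ : size _ <= n)%N) ?size_map_poly //.
    by apply: eq_bigr => k _; rewrite !mxE coef_map.
  transitivity (r i ^+ j * (pQtoC q).[r i]).
    have := congr1 (fun s => (pQtoC s).[r i]) (divp_eq ('X^j * q) p).
    rewrite !rmorphD !rmorphM !hornerE /= root_r mulr0 add0r map_polyXn hornerXn.
    by move=> ->.
  rewrite (bigD1 i) //= big1 => [|k ne_ki]; rewrite !mxE ?eqxx ?addr0 //.
  by rewrite eq_sym in ne_ki; rewrite eq_sym (negPf ne_ki) mulr0n mulr0.
have V0 : \det V != 0.
  rewrite det_Vandermonde; apply/prodf_neq0 => i _; apply/prodf_neq0 => j lt_ij.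
  by rewrite !mxE subr_eq0; apply: contraTneq lt_ij => /inj_r->; rewrite ltnn.
exists (char_poly A); rewrite char_poly_monic; split=> //.
rewrite map_char_poly /= -/A'.
have Vp0 : \det (map_mx polyC V) != 0 by rewrite det_map_mx polyC_eq0.
apply: (mulIf Vp0); rewrite /char_poly -det_mulmx.
have -> : char_poly_mx A' *m map_mx polyC V = map_mx polyC V *m char_poly_mx D.
  rewrite /char_poly_mx mulmxBl mulmxBr -!map_mxM AV.
  by rewrite scalar_mxC.
rewrite det_mulmx mulrC; congr (_ * _).
have <- : char_poly D = \prod_(i < n) ('X - (pQtoC q).[r i]%:P) by
  rewrite char_poly_trig ?diag_mx_is_trig //; apply: eq_bigr => i _; rewrite !mxE eqxx.
by [].
Qed.

(** * Embeddings of a number field *)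

Lemma rmorph_horner_alg (K : fieldExtType rat) (s : {rmorphism K -> algC})
    (q : {poly rat}) (x : K) :
  s (map_poly (in_alg K) q).[x] = (pQtoC q).[s x].
Proof.
rewrite -horner_map -map_poly_comp; congr _.[_]; apply: eq_map_poly => u /=.
by rewrite alg_num_field fmorph_rat.
Qed.

Lemma minCpoly_rmorph (K : fieldExtType rat) (s t : {rmorphism K -> algC}) x :
  minCpoly (s x) = minCpoly (t x).
Proof.
have [p [Dp _] dv_p] := minCpolyP (t x).
apply: minCpoly_root_eq; rewrite Dp /root -rmorph_horner_alg fmorph_eq0.
by rewrite -(fmorph_eq0 t) rmorph_horner_alg -Dp -[_ == 0]/(root _ _) root_minCpoly.
Qed.

Lemma Aint_rmorph (K : fieldExtType rat) (s t : {rmorphism K -> algC}) x :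
  (s x \in Aint) = (t x \in Aint).
Proof. by rewrite !unfold_in (minCpoly_rmorph s t). Qed.

Lemma horner_adjoin1 (K : fieldExtType rat) (x y : K) :
  y \in <<1; x>>%VS -> {q : {poly rat} | y = (map_poly (in_alg K) q).[x]}.
Proof.
move=> xy; apply: sig_eqW; have [p /polyOver1P[q ->] ->] := Fadjoin_polyP xy.
by exists q.
Qed.

Lemma size_minCpoly_rmorph (K : fieldExtType rat) (s : {rmorphism K -> algC}) x :
  size (minCpoly (s x)) = (\dim <<1; x>>%VS).+1.
Proof.
have [p [Dp mon_p] dv_p] := minCpolyP (s x).
have /polyOver1P[q Dq] := minPolyOver 1 x.
have -> : \dim <<1; x>>%VS = adjoin_degree 1 x by rewrite adjoin_degreeE dimv1 divn1.
rewrite -size_minPoly Dp Dq !size_map_poly.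
have mon_q : q \is monic by have := monic_minPoly 1 x; rewrite Dq map_monic.
suffices /eqp_size-> : p %= q by [].
apply/andP; split.
  rewrite -dv_p /root -rmorph_horner_alg -Dq fmorph_eq0.
  by rewrite -[_ == 0]/(root _ _) root_minPoly.
rewrite -(dvdp_map (in_alg K)) -Dq minPoly_dvdp //.
  by apply/polyOver1P; exists p.
rewrite /root -(fmorph_eq0 s) rmorph_horner_alg -Dp.
by rewrite -[_ == 0]/(root _ _) root_minCpoly.
Qed.

Lemma rat_primitive_element (K : fieldExtType rat) :
  exists z : K, (<<1; z>>)%VS = fullv.
Proof.
exists (separable_generator 1 {:K}).
rewrite -(eq_adjoin_separable_generator _ (sub1v _)) //.
apply/separableP => y _; apply: pcharf0_separable => p.
by rewrite (pchar_lalg K) pchar_num.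
Qed.

Lemma conj_embedding (K : fieldExtType rat) (iota : {rmorphism K -> algC}) z r :
    (<<1; z>>)%VS = fullv -> root (minCpoly (iota z)) r ->
  exists s : {rmorphism K -> algC}, s z = r.
Proof.
move=> Kz z_r.
have zP x : {q : {poly rat} | x = (map_poly (in_alg K) q).[z]}.
  by apply: horner_adjoin1; rewrite Kz memvf.
pose f x := (pQtoC (sval (zP x))).[r].
have fE q : f (map_poly (in_alg K) q).[z] = (pQtoC q).[r].
  rewrite /f; case: (zP _) => q' /= Dq'; apply: (horner_minCpoly_root z_r).
  by rewrite -!rmorph_horner_alg Dq'.
have f_zmod : zmod_morphism f.
  move=> x y; have [p Dp] := zP x; have [q Dq] := zP y.
  by rewrite Dp Dq -hornerN -hornerD -rmorphB !fE rmorphB hornerD hornerN.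
have f_mon : monoid_morphism f.
  split=> [|x y].
    by have := fE 1; rewrite !rmorph1 !hornerE.
  have [p Dp] := zP x; have [q Dq] := zP y.
  by rewrite Dp Dq -hornerM -rmorphM !fE rmorphM hornerM.
pose fA := GRing.isZmodMorphism.Build K algC f f_zmod.
pose fM := GRing.isMonoidMorphism.Build K algC f f_mon.
pose fR : {rmorphism K -> algC} := HB.pack f fA fM.
exists fR; have := fE 'X; rewrite !map_polyX !hornerX; exact.
Qed.

Lemma rat_embeddings (K : fieldExtType rat) (iota : {rmorphism K -> algC}) :
  exists (e : 'I_(\dim {:K}) -> {rmorphism K -> algC}) (z : K),
  [/\ injective (fun i => e i z), exists i0, e i0 =1 iota &
      forall x, exists P : {poly rat}, P \is monic /\
        \prod_i ('X - (e i x)%:P) = pQtoC P].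
Proof.
have [z Kz] := rat_primitive_element K.
have [rs Drs uniq_rs] := minCpoly_roots (iota z).
have sz_rs : size rs = \dim {:K}.
  by apply: succn_inj; rewrite -(size_prod_XsubC rs id) -Drs size_minCpoly_rmorph Kz.
have root_rs r : r \in rs -> root (minCpoly (iota z)) r by rewrite Drs root_prod_XsubC.
have eP (i : 'I_(\dim {:K})) : exists s : {rmorphism K -> algC}, s z == rs`_i.
  have [|s <-] := conj_embedding (iota := iota) (r := rs`_i) Kz.
    by rewrite root_rs // mem_nth ?sz_rs.
  by exists s.
have [e eE] : exists e : 'I_(\dim {:K}) -> {rmorphism K -> algC}, forall i, e i z = rs`_i.
  have [e eE] := fin_all_exists eP; exists e => i; exact/eqP.
have eq_ez (s t : {rmorphism K -> algC}) : s z = t z -> s =1 t.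
  move=> st x; have [q ->] : {q : {poly rat} | x = (map_poly (in_alg K) q).[z]}.
    by apply: horner_adjoin1; rewrite Kz memvf.
  by rewrite !rmorph_horner_alg st.
have inj_e : injective (fun i => e i z).
  move=> i j /eqP; rewrite !eE nth_uniq ?sz_rs // => /eqP; exact: val_inj.
exists e, z; split=> // [|x].
  have : iota z \in rs by rewrite -root_prod_XsubC -Drs root_minCpoly.
  case/(nthP 0) => i lt_i Di; rewrite sz_rs in lt_i.
  by exists (Ordinal lt_i); apply: eq_ez; rewrite eE.
have [p [Dp mon_p] _] := minCpolyP (iota z).
have [q Dq] : {q : {poly rat} | x = (map_poly (in_alg K) q).[z]}.
  by apply: horner_adjoin1; rewrite Kz memvf.
have Dpr : pQtoC p = \prod_i ('X - (e i z)%:P).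
  by rewrite -Dp Drs (big_nth 0) sz_rs big_mkord; apply: eq_bigr => i _; rewrite eE.
have [P [mon_P DP]] := prod_horner_rat q Dpr inj_e.
exists P; split=> //; rewrite -DP; apply: eq_bigr => i _.
by rewrite {1}Dq rmorph_horner_alg.
Qed.

(** * The minimal polynomial of 2 - zeta - 1/zeta *)

Lemma mup_XsubC_mul (x : algC) n (R : {poly algC}) :
  ~~ root R x -> mup x (('X - x%:P) ^+ n * R) = n.
Proof. by move=> Rx; rewrite mupMl // mup_XsubCX eqxx. Qed.

Lemma mup_minCpoly_exp (x : algC) k : mup x (minCpoly x ^+ k) = k.
Proof.
have [rs Drs uniq_rs] := minCpoly_roots x.
have x_rs : x \in rs by rewrite -root_prod_XsubC -Drs root_minCpoly.
rewrite Drs (big_rem x) //= exprMn; apply: mup_XsubC_mul.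
rewrite /root horner_exp expf_eq0 negb_and; apply/orP; right.
by rewrite -[_ == 0]/(root _ _) root_prod_XsubC mem_rem_uniqF.
Qed.

Lemma prod_XsubC_minCpoly (ys : seq algC) (x : algC) (P : {poly rat}) :
    P \is monic -> \prod_(y <- ys) ('X - y%:P) = pQtoC P ->
    {in ys, forall y, root (minCpoly x) y} ->
  exists2 k, \prod_(y <- ys) ('X - y%:P) = minCpoly x ^+ k &
             size ys = (k * (size (minCpoly x)).-1)%N.
Proof.
move=> mon_P DP conj_y; have [|k Dk] := rat_poly_conj_power (x := x) mon_P.
  by move=> z; rewrite -DP root_prod_XsubC => /conj_y.
exists k; first by rewrite DP.
have := size_exp (minCpoly x) k.
by rewrite -Dk -DP (size_prod_XsubC ys id) mulnC.
Qed.

Definition two_sub_trace (w : algC) : algC := 2 - w - w^-1.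

Section CyclotomicTrace.

Variables (d : nat) (zeta : algC).
Hypotheses (prim_zeta : d.-primitive_root zeta) (d_gt2 : (2 < d)%N).
Let beta := two_sub_trace zeta.

Lemma prim_root_conj (w : algC) : root (minCpoly zeta) w = d.-primitive_root w.
Proof. by rewrite (minCpoly_cyclotomic prim_zeta) root_cyclotomic. Qed.

Lemma prim_root_inv (w : algC) : d.-primitive_root w -> w^-1 = w ^+ d.-1.
Proof.
move=> prim_w; have w0 : w != 0.
  by rewrite (prim_root_eq0 prim_w); case: d d_gt2.
by apply: (mulfI w0); rewrite mulfV // -exprS prednK ?prim_expr_order // (ltn_trans _ d_gt2).
Qed.

Let trace_poly : {poly rat} := 2%:P - 'X - 'X^(d.-1).

Let two_sub_traceE w : d.-primitive_root w -> two_sub_trace w = (pQtoC trace_poly).[w].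
Proof.
move=> prim_w; rewrite /two_sub_trace (prim_root_inv prim_w) /trace_poly.
by rewrite !rmorphB /= map_polyC map_polyX map_polyXn !hornerE /= rmorph_nat.
Qed.

Lemma two_sub_trace_conj w : d.-primitive_root w -> root (minCpoly beta) (two_sub_trace w).
Proof.
move=> prim_w; have [p [Dp _] dv_p] := minCpolyP beta.
have := root_minCpoly beta; rewrite Dp /beta !two_sub_traceE // /root -!horner_comp
  -!map_comp_poly.
move=> /eqP pz0; apply/eqP.
have /(@horner_minCpoly_root _ _ (p \Po trace_poly) 0)-> : root (minCpoly zeta) w
  by rewrite prim_root_conj.
  by rewrite rmorph0 horner0.
by rewrite pz0 rmorph0 horner0.
Qed.

Lemma two_sub_trace_eq w : w != 0 -> two_sub_trace w = beta -> w = zeta \/ w = zeta^-1.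
Proof.
move=> w0 /eqP; have z0 : zeta != 0.
  by rewrite (prim_root_eq0 prim_zeta); case: d d_gt2.
rewrite -subr_eq0 => /eqP eq_wz.
have : (w - zeta) * (w * zeta - 1) = 0.
  have -> : (w - zeta) * (w * zeta - 1) = - (w * zeta) * (two_sub_trace w - beta).
    by rewrite /beta /two_sub_trace; field; rewrite w0 z0.
  by rewrite eq_wz mulr0.
move/eqP; rewrite mulf_eq0 !subr_eq0 => /orP[/eqP|/eqP wz]; [by left|right].
by rewrite -[zeta^-1]mul1r -wz mulfK.
Qed.

Lemma minCpoly_two_sub_trace (rs : seq algC) :
    uniq rs -> minCpoly zeta = \prod_(r <- rs) ('X - r%:P) ->
  \prod_(r <- rs) ('X - (two_sub_trace r)%:P) = minCpoly beta ^+ 2 /\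
  totient d = (2 * (size (minCpoly beta)).-1)%N.
Proof.
move=> uniq_rs Drs.
have prim_rs r : (r \in rs) = d.-primitive_root r.
  by rewrite -root_prod_XsubC -Drs prim_root_conj.
have [p [Dp _] _] := minCpolyP zeta.
have Dpr : pQtoC p = \prod_(i < size rs) ('X - (rs`_i)%:P).
  by rewrite -Dp Drs (big_nth 0) big_mkord.
have inj_r : injective (fun i : 'I_(size rs) => rs`_i).
  by move=> i j /eqP; rewrite nth_uniq // => /eqP/val_inj.
have [P [mon_P DP]] := prod_horner_rat trace_poly Dpr inj_r.
have DS : \prod_(y <- map two_sub_trace rs) ('X - y%:P) = pQtoC P.
  rewrite -DP big_map (big_nth 0) big_mkord; apply: eq_bigr => i _.
  by rewrite two_sub_traceE // -prim_rs mem_nth.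
have [|k Dk szk] := prod_XsubC_minCpoly (x := beta) mon_P DS.
  by move=> _ /mapP[w w_rs ->]; apply: two_sub_trace_conj; rewrite -prim_rs.
have sz_rs : size rs = totient d.
  apply: succn_inj; rewrite -(size_prod_XsubC rs id) -Drs.
  by rewrite (minCpoly_cyclotomic prim_zeta) size_cyclotomic.
have z0 : zeta != 0 by rewrite (prim_root_eq0 prim_zeta); case: d d_gt2.
have z_rs : zeta \in rs by rewrite prim_rs.
have zV_neq : zeta^-1 != zeta.
  apply/eqP => zV; have : zeta ^+ 2 == zeta ^+ 0.
    by rewrite expr2 -{1}zV mulVf.
  by rewrite (eq_prim_root_expr prim_zeta) mod0n modn_small.
have zV_rs : zeta^-1 \in rs.
  rewrite prim_rs (prim_root_inv prim_zeta) prim_root_exp_coprime //.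
  by rewrite coprime_sym coprimenP // (ltn_trans _ d_gt2).
suffices k2 : k = 2%N by rewrite -sz_rs -k2 -Dk big_map -szk size_map.
have := mup_minCpoly_exp beta k; rewrite -Dk big_map => <-.
rewrite (big_rem zeta) //= (big_rem zeta^-1) /=; last first.
  by rewrite (rem_filter zeta uniq_rs) mem_filter /= zV_neq.
rewrite (_ : two_sub_trace zeta^-1 = beta); last first.
  by rewrite /beta /two_sub_trace invrK addrAC.
rewrite -/beta mulrA -expr2 mup_XsubC_mul //.
rewrite -(big_map two_sub_trace predT (fun y => 'X - y%:P)) root_prod_XsubC.
apply/mapP => -[w w_rs' /esym tw].
have := w_rs'; rewrite mem_rem_uniq ?rem_uniq // inE => /andP[w_zV].
rewrite mem_rem_uniq // inE => /andP[w_z w_rs].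
have w0 : w != 0.
  by move: w_rs; rewrite prim_rs => /prim_root_eq0 ->; case: d d_gt2.
by case: (two_sub_trace_eq w0 tw) => Dw; rewrite Dw eqxx in w_zV w_z.
Qed.

End CyclotomicTrace.

(** * Cyclotomic polynomials at 1 *)

Definition cyclotomic_at1 (d : nat) : nat := if primes d is [:: p] then p else 1%N.

Lemma Cyclotomic_prime_power p k : prime p ->
  'Phi_(p ^ k.+1) = \sum_(i < p) 'X^(p ^ k * i)%N.
Proof.
move=> p_pr; have pk_gt0 j : (0 < p ^ j)%N by rewrite expn_gt0 prime_gt0.
have nz : ('X^(p ^ k) - 1 : {poly int}) != 0.
  by rewrite -size_poly_eq0 size_XnsubC.
apply: (mulIf nz).
transitivity ('X^(p ^ k.+1) - 1 : {poly int}); last first.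
  rewrite mulrC expnSr exprM subrX1; congr (_ * _).
  by apply: eq_bigr => i _; rewrite exprM.
rewrite -!prod_Cyclotomic //.
have dv : perm_eq (divisors (p ^ k.+1)) (p ^ k.+1 :: divisors (p ^ k))%N.
  apply: uniq_perm; rewrite ?divisors_uniq //=.
    rewrite divisors_uniq andbT -dvdn_divisors // dvdn_Pexp2l ?prime_gt1 //.
    by rewrite ltnn.
  move=> e; rewrite inE -!dvdn_divisors //.
  apply/idP/orP => [/dvdn_pfactor|[/eqP-> //|]]; last first.
    by move/dvdn_trans; apply; rewrite dvdn_exp2l.
  case/(_ p_pr) => j; rewrite leq_eqVlt => /orP[/eqP->|lt_jk] ->; [by left|right].
  by rewrite dvdn_exp2l.
by rewrite (perm_big _ dv) big_cons.
Qed.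

Lemma Aint_divr_1sub_prim_root d q (z : algC) :
  d.-primitive_root z -> (q %| d)%N -> (1 < q)%N -> q%:R / (1 - z) \in Aint.
Proof.
move=> prim_z q_d q_gt1; have d_gt0 := prim_order_gt0 prim_z.
have [z1|z1] := eqVneq z 1; first by rewrite z1 subrr invr0 mulr0 Aint0.
have zA := Aint_prim_root prim_z.
have prim_t := dvdn_prim_root prim_z q_d; set t := z ^+ _ in prim_t.
have t1 : t != 1.
  by rewrite -(expr0 t) -[t]expr1 (eq_prim_root_expr prim_t) mod0n modn_small.
have sum_t : \sum_(i < q) t ^+ i = 0.
  have := subrX1 t q; rewrite prim_expr_order // subrr => /esym/eqP.
  by rewrite mulf_eq0 subr_eq0 (negPf t1) => /eqP.
have -> : q%:R = \sum_(i < q) (1 - t ^+ i).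
  by rewrite sumrB sum_t subr0 sumr_const card_ord.
rewrite mulr_suml; apply: rpred_sum => i _.
rewrite -exprM -opprB subrX1 -mulNr opprB mulrAC mulfV ?subr_eq0 1?eq_sym // mul1r.
by apply: rpred_sum => j _; apply: rpredX.
Qed.

Lemma Aint_inv_1sub_prim_root d (z : algC) p q :
    d.-primitive_root z -> prime p -> prime q -> p != q ->
    (p %| d)%N -> (q %| d)%N -> (1 - z)^-1 \in Aint.
Proof.
move=> prim_z p_pr q_pr ne_pq p_d q_d.
have /coprimeP-/(_ (prime_gt0 p_pr)) [[u v] /= uv] : coprime p q.
  by rewrite prime_coprime // dvdn_prime2.
have -> : (1 - z)^-1 = u%:R * (p%:R / (1 - z)) - v%:R * (q%:R / (1 - z)).
  by rewrite !mulrA -mulrBl -!natrM -natrB ?uv ?mul1r //; lia.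
have [p1 q1] := (prime_gt1 p_pr, prime_gt1 q_pr).
by rewrite rpredB // rpredM ?rpred_nat // (Aint_divr_1sub_prim_root prim_z).
Qed.

Lemma norm_minCpoly_prim_root1 d (z : algC) : (1 < d)%N ->
  d.-primitive_root z -> `|(minCpoly z).[1]| = (cyclotomic_at1 d)%:R.
Proof.
move=> d_gt1 prim_z; have d_gt0 := ltnW d_gt1.
have DPhi : minCpoly z = map_poly intr 'Phi_d.
  by rewrite (Cintr_Cyclotomic prim_z) (minCpoly_cyclotomic prim_z).
rewrite /cyclotomic_at1.
case Dps: (primes d) => [|p [|q ps]].
- by move/eqP: Dps; rewrite primes_eq0 ltnNge d_gt1.
- have : p \in primes d by rewrite Dps mem_head.
  rewrite mem_primes d_gt0 /= => /andP[p_pr p_d].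
  have Dd : d = (p ^ logn p d)%N by rewrite {1}(prod_prime_decomp d_gt0) prime_decompE Dps
    big_seq1.
  have : (0 < logn p d)%N by rewrite logn_gt0 Dps mem_head.
  rewrite DPhi; case: (logn p d) Dd => // k -> _.
  rewrite Cyclotomic_prime_power // rmorph_sum horner_sum /=.
  rewrite (eq_bigr (fun=> 1)); last by move=> i _; rewrite map_polyXn hornerXn expr1n.
  by rewrite sumr_const card_ord normr_nat.
have [rs Drs uniq_rs] := minCpoly_roots z.
have prim_rs r : r \in rs -> d.-primitive_root r.
  by rewrite -root_prod_XsubC -Drs (prim_root_conj prim_z).
have Dg : (minCpoly z).[1] = \prod_(r <- rs) (1 - r).
  by rewrite Drs horner_prod; apply: eq_bigr => r _; rewrite !hornerE.
have [p_d q_d ne_pq] : [/\ p \in primes d, q \in primes d & p != q].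
  have := primes_uniq d; rewrite Dps /= inE negb_or => /andP[/andP[-> _] _].
  by rewrite !inE !eqxx orbT.
move: p_d q_d; rewrite !mem_primes => /and3P[p_pr _ p_d] /and3P[q_pr _ q_d].
have g_rat : (minCpoly z).[1] \in Crat.
  by rewrite DPhi -(rmorph1 intr) horner_map /= rpred_int.
have g_int : (minCpoly z).[1] \in Num.int.
  by rewrite DPhi -(rmorph1 intr) horner_map /= intr_int.
have gV_int : (minCpoly z).[1]^-1 \in Num.int.
  apply: Cint_rat_Aint; first by rewrite rpredV.
  rewrite Dg -prodfV big_seq rpred_prod // => r /prim_rs prim_r.
  exact: (Aint_inv_1sub_prim_root prim_r p_pr q_pr).
have g0 : (minCpoly z).[1] != 0.
  rewrite Dg prodf_seq_neq0; apply/allP => r /prim_rs prim_r /=.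
  rewrite subr_eq0; apply: contraTneq prim_r => <-.
  apply/negP => prim_1; have := eq_prim_root_expr prim_1 1 0.
  by rewrite expr1 expr0 eqxx mod0n modn_small.
apply/eqP; rewrite eq_le norm_intr_ge1 // andbT.
have := norm_intr_ge1 gV_int; rewrite invr_eq0 => /(_ g0).
by rewrite normfV invf_ge1 ?normr_gt0.
Qed.

(** * The angle of d.-root (-1) *)

Lemma unit_circle_rotation (R : realFieldType) (p q r s : R) :
    p ^+ 2 + q ^+ 2 = 1 -> r ^+ 2 + s ^+ 2 = 1 -> 0 <= q -> 0 <= s -> p <= r -> r != 1 ->
  0 <= q * r - p * s /\ p < p * r + q * s.
Proof.
move=> pq rs q0 s0 pr r1.
have r_lt1 : r < 1 by rewrite lt_neqAle r1; nra.
have p_gem1 : -1 <= p by nra.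
have q2 : q ^+ 2 = 1 - p ^+ 2 by lra.
have s2 : s ^+ 2 = 1 - r ^+ 2 by lra.
have sq_diff : (q * r) ^+ 2 - (p * s) ^+ 2 = r ^+ 2 - p ^+ 2.
  by rewrite !exprMn q2 s2; ring.
split.
  have [p0|p0] := lerP 0 p.
    have : (p * s) ^+ 2 <= (q * r) ^+ 2 by rewrite -subr_ge0 sq_diff subr_sqr mulr_ge0 //; lra.
    have r0 : 0 <= r := le_trans p0 pr.
    by rewrite ler_pXn2r ?nnegrE ?mulr_ge0 // => ?; lra.
  have [r0|r0] := lerP 0 r; first by nra.
  have : (q * - r) ^+ 2 <= (- p * s) ^+ 2.
    rewrite -subr_ge0 mulrN mulNr !sqrrN -opprB sq_diff opprB subr_sqr.
    by rewrite mulr_le0 //; lra.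
  rewrite ler_pXn2r ?nnegrE ?mulr_ge0 ?oppr_ge0 ?(ltW r0) ?(le_trans pr (ltW r0)) // => ?.
  by lra.
have [p0|p0] := lerP p 0.
  have qs0 : 0 <= q * s by apply: mulr_ge0.
  have [p00|p00] := eqVneq p 0; last first.
    have p_lt0 : p < 0 by rewrite lt_neqAle p00.
    by nra.
  have q1 : q = 1.
    by apply/eqP; rewrite -(@pexpr_eq1 _ _ 2) // q2 p00 expr0n subr0.
  rewrite p00 q1 mul0r add0r mul1r lt_neqAle s0 andbT eq_sym.
  apply: contra_neq r1 => s00; apply/eqP; rewrite -(@pexpr_eq1 _ _ 2) //; last by lra.
  by apply/eqP; rewrite s00 in rs; lra.
have : (p * (1 - r)) ^+ 2 < (q * s) ^+ 2.
  rewrite -subr_gt0.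
  have -> : (q * s) ^+ 2 - (p * (1 - r)) ^+ 2 = (1 - r) * (1 + r - 2 * p ^+ 2).
    by rewrite !exprMn q2 s2; ring.
  by apply: mulr_gt0; nra.
by rewrite ltr_pXn2r ?nnegrE ?mulr_ge0 ?subr_ge0 ?(ltW p0) ?(ltW r_lt1) // => ?; lra.
Qed.

Lemma Re_Im_rotation (x w : algC) :
    `|x| = 1 -> `|w| = 1 -> 0 <= 'Im x -> 0 <= 'Im w -> 'Re x <= 'Re w -> w != 1 ->
  0 <= 'Im (x * w^*) /\ 'Re x < 'Re (x * w^*).
Proof.
move=> x1 w1 Ix Iw Rxw w_neq1.
pose p := in_algR (Creal_Re x); pose q := in_algR (Creal_Im x).
pose r := in_algR (Creal_Re w); pose s := in_algR (Creal_Im w).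
have pq : p ^+ 2 + q ^+ 2 = 1 by apply: val_inj; rewrite /= -normC2_Re_Im x1 expr1n.
have rs : r ^+ 2 + s ^+ 2 = 1 by apply: val_inj; rewrite /= -normC2_Re_Im w1 expr1n.
have r1 : r != 1.
  apply: contra_neq w_neq1 => r1; rewrite [w]algCrect.
  have -> : 'Re w = val r by [].
  have s0 : s = 0 by apply/eqP; rewrite -sqrf_eq0; apply/eqP; move: rs; rewrite r1; lra.
  by rewrite -[ 'Im w]/(val s) s0 r1 /= mulr0 addr0.
have [I R] := unit_circle_rotation pq rs Ix Iw Rxw r1.
have {}I : 0 <= 'Im x * 'Re w - 'Re x * 'Im w := I.
have {}R : 'Re x < 'Re x * 'Re w + 'Im x * 'Im w := R.
by rewrite ImM ReM Re_conj Im_conj !mulrN opprK addrC ['Re w * _]mulrC.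
Qed.

Lemma norm_unity_root n (x : algC) : (0 < n)%N -> x ^+ n = 1 -> `|x| = 1.
Proof.
move=> n_gt0 xn; apply/eqP; rewrite -(@pexpr_eq1 _ _ n) //.
by rewrite -normrX xn normr1.
Qed.

Lemma invC_norm1 (x : algC) : `|x| = 1 -> x^-1 = x^*.
Proof. by move=> x1; rewrite invC_norm x1 expr1n invr1 mul1r. Qed.

(* Rotating back by the root w of smallest positive argument is a Euclidean
   division of arguments, so w generates the group of roots of unity. *)
Lemma prim_root_Re_max D (w : algC) : (0 < D)%N -> w ^+ D = 1 -> w != 1 -> 0 <= 'Im w ->
    (forall x, x ^+ D = 1 -> x != 1 -> 0 <= 'Im x -> 'Re x <= 'Re w) ->
  D.-primitive_root w.
Proof.
move=> D_gt0 wD w1 Iw w_max.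
have [z prim_z] := C_prim_root_exists D_gt0.
pose L := [seq z ^+ i | i <- iota 0 D].
have memL x : x ^+ D = 1 -> x \in L.
  move=> /(prim_rootP prim_z)[i ->]; apply/mapP; exists (val i) => //.
  by rewrite mem_iota /=.
have powers x : x ^+ D = 1 -> 0 <= 'Im x -> exists k, x = w ^+ k.
  pose A u := [set i : 'I_D | 'Re u < 'Re (z ^+ i)].
  have [n] := ubnP #|A x|; elim: n x => // n IHn x lt_n xD Ix.
  have [->|x1] := eqVneq x 1; first by exists 0%N.
  have nx := norm_unity_root D_gt0 xD; have nw := norm_unity_root D_gt0 wD.
  have [Ixw Rxw] := Re_Im_rotation nx nw Ix Iw (w_max x xD x1 Ix) w1.
  have xwD : (x * w^*) ^+ D = 1 by rewrite exprMn xD -rmorphXn /= wD rmorph1 mulr1.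
  have [|k Dk] := IHn _ _ xwD Ixw; last first.
    exists k.+1; rewrite exprSr -Dk -mulrA [_^* * _]mulrC -normCK nw expr1n.
    by rewrite mulr1.
  rewrite -ltnS; apply: leq_trans lt_n; rewrite ltnS; apply: proper_card.
  apply/properP; split.
    by apply/subsetP => i; rewrite !inE; apply: lt_trans.
  have [i Di] := prim_rootP prim_z xwD.
  by exists i; rewrite !inE -Di // ltxx.
have [m prim_w m_D] := prim_order_exists D_gt0 wD.
suffices D_m : (D %| m)%N by rewrite -(eqP (_ : m == D)) // eqn_dvd m_D.
have zD := prim_expr_order prim_z; have z1 := norm_unity_root D_gt0 zD.
rewrite (prim_order_dvd prim_z); have Iz : 'Im z \is Num.real by apply: Creal_Im.
have [Iz0|/ltW Iz0] := real_ge0P Iz.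
  by have [k ->] := powers z zD Iz0; rewrite exprAC (prim_expr_order prim_w) expr1n.
have zVD : z^* ^+ D = 1 by rewrite -rmorphXn /= zD rmorph1.
have [|k Dk] := powers _ zVD; first by rewrite Im_conj oppr_ge0.
rewrite -(inj_eq (inv_inj (@conjCK _))) rmorphXn /= Dk rmorph1.
by rewrite exprAC (prim_expr_order prim_w) expr1n.
Qed.

Section RootOfMinusOne.

Variable d : nat.
Hypothesis d_gt1 : (1 < d)%N.
Let d_gt0 : (0 < d)%N. Proof. exact: ltnW. Qed.
Let eta : algC := d.-root (-1).

Let eta_d : eta ^+ d = -1. Proof. exact: rootCK. Qed.

Lemma rootCN1_prim : (d * 2).-primitive_root eta.
Proof.
have Ieta : 0 <= 'Im eta by apply: Im_rootC_ge0.
have D_gt0 : (0 < d * 2)%N by rewrite muln_gt0 d_gt0.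
have etaD : eta ^+ (d * 2) = 1 by rewrite exprM eta_d sqrrN expr1n.
have eta1 : eta != 1.
  apply/eqP => e1; have := eta_d; rewrite e1 expr1n => /eqP.
  by rewrite -subr_eq0 opprK (pnatr_eq0 _ 2).
apply: prim_root_Re_max => // x xD x1 Ix.
have /eqP := xD; rewrite exprM sqrf_eq1 => /orP[/eqP xd|/eqP xd]; last first.
  exact: rootC_Re_max.
have [//|lt_Re] := real_leP (Creal_Re x) (Creal_Re eta).
have nx := norm_unity_root D_gt0 xD; have ne := norm_unity_root D_gt0 etaD.
have [I R] := Re_Im_rotation ne nx Ieta Ix (ltW lt_Re) x1.
have := @rootC_Re_max _ d (-1) (eta * x^*) d_gt0 _ I.
rewrite -/eta exprMn eta_d -rmorphXn /= xd rmorph1 mulr1 => /(_ erefl).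
by move=> le_Re; have := lt_le_trans R le_Re; rewrite ltxx.
Qed.

Lemma rootCN1_sqr_prim : d.-primitive_root (eta ^+ 2).
Proof.
have := exp_prim_root rootCN1_prim 2.
have -> : gcdn 2 (d * 2) = 2%N by apply/gcdn_idPl; rewrite dvdn_mull.
by rewrite mulnK.
Qed.

Lemma four_sub_cospi : 4 - 4 * cospi d ^+ 2 = two_sub_trace (eta ^+ 2).
Proof.
have eta1 : `|eta| = 1.
  by apply: norm_unity_root (prim_expr_order rootCN1_prim); rewrite muln_gt0 d_gt0.
have eta0 : eta != 0 by rewrite -normr_eq0 eta1 oner_eq0.
rewrite /cospi /two_sub_trace ReE -/eta -invC_norm1 //.
by field; rewrite eta0.
Qed.

End RootOfMinusOne.

Lemma norm_1subX_le (z : algC) k : `|z| = 1 -> `|1 - z ^+ k| <= k%:R * `|1 - z|.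
Proof.
move=> z1; rewrite -opprB subrX1 -mulNr opprB normrM mulrC.
apply: ler_wpM2r => //; apply: le_trans (ler_norm_sum _ _ _) _.
rewrite (eq_bigr (fun=> 1)); last by move=> i _; rewrite normrX z1 expr1n.
by rewrite sumr_const card_ord.
Qed.

Lemma two_sub_trace_norm (z : algC) : `|z| = 1 -> two_sub_trace z = `|1 - z| ^+ 2.
Proof.
move=> z1; have z0 : z != 0 by rewrite -normr_eq0 z1 oner_eq0.
rewrite normCK rmorphB rmorph1 /= -invC_norm1 // /two_sub_trace.
by field.
Qed.

Definition coprime_dist_prod (d : nat) : nat := \prod_(k < d | coprime k d) minn k (d - k).

(* Phi_d(1) is the product of the 1 - z^k, k coprime to d, and
   |1 - z^k| <= min(k, d - k) |1 - z|. *)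
Lemma two_sub_trace_lower_bound d (z : algC) : (1 < d)%N -> d.-primitive_root z ->
  (cyclotomic_at1 d)%:R ^+ 2 <= (coprime_dist_prod d)%:R ^+ 2 * two_sub_trace z ^+ totient d.
Proof.
move=> d_gt1 prim_z; have d_gt0 := ltnW d_gt1; have zd := prim_expr_order prim_z.
have z1 := norm_unity_root d_gt0 zd.
rewrite two_sub_trace_norm // exprAC -exprMn.
rewrite ler_pXn2r ?nnegrE ?mulr_ge0 ?ler0n ?exprn_ge0 //.
rewrite -(norm_minCpoly_prim_root1 d_gt1 prim_z) (minCpoly_cyclotomic prim_z).
rewrite horner_prod normr_prod /coprime_dist_prod natr_prod.
have -> : `|1 - z| ^+ totient d = \prod_(k < d | coprime k d) `|1 - z|.
  rewrite prodr_const; congr (_ ^+ _).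
  rewrite totient_count_coprime -big_mkcond big_mkord -sum1_card.
  by apply: eq_bigl => k; rewrite coprime_sym.
rewrite -big_split /=; apply: ler_prod => k _; rewrite normr_ge0 !hornerE /=.
rewrite /minn; case: ifP => _; first exact: norm_1subX_le.
have <- : `|1 - z ^+ (d - k)| = `|1 - z ^+ k|; last exact: norm_1subX_le.
have zk1 : `|z ^+ k| = 1 by rewrite normrX z1 expr1n.
rewrite -[LHS]mul1r -[X in X * _ = _]zk1 -normrM mulrBr mulr1 -exprD subnKC ?zd;
  last exact: ltnW.
by rewrite distrC.
Qed.

(** * Norms from the ground field *)

Lemma norm_prod_rmorph_ge1 (K : fieldExtType rat) n (e : 'I_n -> {rmorphism K -> algC})
    (iota : {rmorphism K -> algC}) (x : K) (P : {poly rat}) :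
    \prod_i ('X - (e i x)%:P) = map_poly ratr P -> x != 0 -> iota x \in Aint ->
  1 <= `|\prod_i e i x|.
Proof.
move=> DP x0 xA; apply: norm_intr_ge1; last first.
  by apply/prodf_neq0 => i _; rewrite fmorph_eq0.
apply: Cint_rat_Aint; last first.
  by apply: rpred_prod => i _; rewrite (Aint_rmorph _ iota).
have -> : \prod_i e i x = (-1) ^+ n * ratr P.[0].
  have <- : (map_poly (ratr : rat -> algC) P).[0] = ratr P.[0].
    by rewrite -horner_map rmorph0.
  rewrite -DP horner_prod -[in (-1) ^+ _](card_ord n) -prodr_const -big_split /=.
  by apply: eq_bigr => i _; rewrite !hornerE mulN1r opprK.
by rewrite rpredM ?rpredX ?rpredN ?rpred1 ?Crat_rat.
Qed.

Lemma mup_prod_XsubC1 n (y : 'I_n -> algC) i0 :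
  (forall i, i != i0 -> y i != y i0) -> mup (y i0) (\prod_i ('X - (y i)%:P)) = 1%N.
Proof.
move=> y_neq; rewrite (bigD1 i0) //= -['X - (y i0)%:P]expr1; apply: mup_XsubC_mul.
rewrite /root horner_prod; apply/prodf_neq0 => i ne_i.
by rewrite !hornerE subr_eq0 eq_sym y_neq.
Qed.

Lemma prim_root_trace_bounds d (zeta w : algC) :
    d.-primitive_root zeta -> (2 < d)%N -> root (minCpoly (two_sub_trace zeta)) w ->
  w \is Num.real /\ w <= 4.
Proof.
move=> prim_z d_gt2; have d_gt0 : (0 < d)%N by lia.
have [rs Drs uniq_rs] := minCpoly_roots zeta.
have [DS _] := minCpoly_two_sub_trace prim_z d_gt2 uniq_rs Drs.
move=> pw0; have : root (\prod_(y <- map two_sub_trace rs) ('X - y%:P)) w.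
  by rewrite big_map DS root_exp // /comm_poly mulrC.
rewrite root_prod_XsubC => /mapP[r r_rs ->].
have prim_r : d.-primitive_root r.
  by rewrite -(prim_root_conj prim_z) Drs root_prod_XsubC.
have r1 := norm_unity_root d_gt0 (prim_expr_order prim_r).
rewrite two_sub_trace_norm //; split; first by rewrite rpredX // normr_real.
have -> : 4 = 2 ^+ 2 :> algC by rewrite -natrX.
rewrite ler_pXn2r ?nnegrE ?ler0n //; apply: le_trans (ler_normB _ _) _.
by rewrite r1 normr1 -(natrD _ 1 1).
Qed.

Lemma norm_minCpoly_trace0 d (zeta : algC) :
    d.-primitive_root zeta -> (2 < d)%N ->
  `|(minCpoly (two_sub_trace zeta)).[0]| = (cyclotomic_at1 d)%:R.
Proof.
move=> prim_z d_gt2; have d_gt0 : (0 < d)%N by lia.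
have [rs Drs uniq_rs] := minCpoly_roots zeta.
have [DS _] := minCpoly_two_sub_trace prim_z d_gt2 uniq_rs Drs.
have prim_rs r : r \in rs -> d.-primitive_root r.
  by rewrite -root_prod_XsubC -Drs (prim_root_conj prim_z).
apply/eqP; rewrite -(eqrXn2 (n := 2)) ?normr_ge0 ?ler0n // -normrX -horner_exp -DS.
rewrite -(norm_minCpoly_prim_root1 _ prim_z); last by lia.
rewrite Drs !horner_prod !normr_prod -prodrXl; apply/eqP.
apply: eq_big_seq => r /prim_rs prim_r; rewrite !hornerE normrN.
rewrite two_sub_trace_norm ?normrX ?normr_id //.
exact: norm_unity_root (prim_expr_order prim_r).
Qed.

Lemma Fadjoin_trace (K : fieldExtType rat) (c : K) :
  (<<1; 4 - 4 * c>>)%VS = (<<1; c>>)%VS.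
Proof.
have mem4 (E : {subfield K}) : 4 \in E by rewrite rpred_nat.
apply/eqP; rewrite eqEsubv !sub_adjoin1v; apply/andP; split.
  by rewrite rpredB ?mem4 // rpredM ?mem4 ?memv_adjoin.
rewrite [X in X \in _](_ : c = 4^-1 * (4 - (4 - 4 * c))); last first.
  by field; rewrite -(rmorph_nat (in_alg K)) fmorph_eq0.
by rewrite rpredM ?rpredV ?mem4 // rpredB ?mem4 ?memv_adjoin.
Qed.

Lemma adjoin2_real (K : fieldExtType rat) (c a : K) (s : {rmorphism K -> algC}) :
    (<<<<1; c>>; a>>)%VS = fullv -> s c \is Num.real -> s a \is Num.real ->
  forall x, s x \is Num.real.
Proof.
move=> Kca c_real a_real x.
have : x \in <<<<1; c>>; a>>%VS by rewrite Kca memvf.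
case/Fadjoin_polyP => q /polyOverP q_c ->.
rewrite -horner_map rpred_horner //; apply/polyOverP => j; rewrite coef_map /=.
have [p /polyOver1P[r ->] ->] := Fadjoin_polyP (q_c j).
rewrite rmorph_horner_alg rpred_horner //; apply/polyOverP => k.
by rewrite coef_map Creal_Crat ?Crat_rat.
Qed.

Section GroundField.

Variables (d : nat) (K : fieldExtType rat) (iota : {rmorphism K -> algC}) (c a : K).
Hypothesis d_ge3 : (3 <= d)%N.
Hypothesis iota_c : iota c = cospi d ^+ 2.
Hypothesis K_gen : (<<<<1; c>>; a>>)%VS = fullv.
Hypothesis a_real : forall sigma : {rmorphism K -> algC}, sigma a \is Num.real.
Hypothesis a_gt4 : 4 < iota a.
Hypothesis a_conj : forall sigma : {rmorphism K -> algC},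
  (forall x : K, sigma x \is Num.real) -> (exists x : K, sigma x != iota x) ->
  0 < sigma a < sigma (4 - 4 * c).

Let b := 4 - 4 * c.
Let zeta : algC := d.-root (-1) ^+ 2.

Let iota_b : iota b = two_sub_trace zeta.
Proof.
by rewrite /b rmorphB rmorphM !rmorph_nat iota_c four_sub_cospi // (leq_trans _ d_ge3).
Qed.

Let prim_zeta : d.-primitive_root zeta.
Proof. by apply: rootCN1_sqr_prim; rewrite (leq_trans _ d_ge3). Qed.

Let conj_b (s : {rmorphism K -> algC}) : s b \is Num.real /\ s b <= 4.
Proof.
apply: (prim_root_trace_bounds prim_zeta d_ge3).
by rewrite -iota_b -(minCpoly_rmorph s) root_minCpoly.
Qed.

Let s_real (s : {rmorphism K -> algC}) x : s x \is Num.real.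
Proof.
apply: (adjoin2_real K_gen) => //.
have -> : c = 4^-1 * (4 - b).
  by rewrite /b; field; rewrite -(rmorph_nat (in_alg K)) fmorph_eq0.
have [b_real _] := conj_b s.
by rewrite rmorphM fmorphV rmorphB !rmorph_nat rpredM ?rpredV ?rpredB ?realn.
Qed.

Lemma real_embeddings :
  (<<1; a>>)%VS = fullv /\
  exists (tau : 'I_(\dim {:K}) -> {rmorphism K -> algR}) (i0 : 'I_(\dim {:K})),
  [/\ forall x, val (tau i0 x) = iota x,
      forall i, i != i0 -> 0 < tau i a < tau i b,
      forall x, iota x \in Aint -> x != 0 -> 1 <= `|\prod_i tau i x|,
      `|\prod_i tau i b| = (cyclotomic_at1 d)%:R ^+ (\dim_(<<1; c>>) {:K})
    & (2 * \dim {:K} = \dim_(<<1; c>>) {:K} * totient d)%N /\ (2 * \dim <<1;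
      c>> = totient d)%N].
Proof.
have [e [z [inj_e [i0 e_i0] eP]]] := rat_embeddings iota.
have e_conj i : i != i0 -> 0 < e i a < e i b.
  move=> ne_i; apply: a_conj; first exact: s_real.
  exists z; rewrite -e_i0; apply: contra_neq ne_i; exact: inj_e.
have zm i : zmod_morphism (fun x => in_algR (s_real (e i) x)).
  by move=> x y; apply: val_inj; rewrite /= rmorphB.
have mm i : monoid_morphism (fun x => in_algR (s_real (e i) x)).
  by split=> [|x y]; apply: val_inj; rewrite /= ?rmorph1 ?rmorphM.
pose tau i : {rmorphism K -> algR} := HB.pack (fun x => in_algR (s_real (e i) x))
   (GRing.isZmodMorphism.Build K algR _ (zm i)) (GRing.isMonoidMorphism.Build K algR _ (mm i)).
have val_prod x : val (\prod_i tau i x) = \prod_i e i x by rewrite (rmorph_prod algRval).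
have dimK : \dim {:K} = (\dim_(<<1; c>>) {:K} * \dim <<1; c>>)%N.
  by rewrite -dim_sup_field ?subvf.
have dimF : (2 * \dim <<1; c>> = totient d)%N.
  have [rs Drs uniq_rs] := minCpoly_roots zeta.
  have [_ ->] := minCpoly_two_sub_trace prim_zeta d_ge3 uniq_rs Drs.
  by rewrite -iota_b size_minCpoly_rmorph Fadjoin_trace.
split.
  have [P [mon_P DP]] := eP a.
  have DP' : \prod_(y <- [seq e i a | i <- enum 'I_(\dim {:K})]) ('X - y%:P) = map_poly ratr P.
    by rewrite big_map big_enum.
  have [|k Dk szk] := prod_XsubC_minCpoly (x := iota a) mon_P DP'.
    by move=> _ /mapP[i _ ->]; rewrite -(minCpoly_rmorph (e i)) root_minCpoly.
  have := mup_minCpoly_exp (iota a) k; rewrite -Dk big_map big_enum /= -e_i0.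
  rewrite mup_prod_XsubC1 => [k1|i ne_i]; last first.
    have /andP[_ ab] := e_conj i ne_i; have [_ b4] := conj_b (e i).
    by rewrite e_i0 lt_eqF // (lt_trans ab) // (le_lt_trans b4).
  move: szk; rewrite size_map size_enum_ord -k1 mul1n size_minCpoly_rmorph /= => dim_a.
  by apply/eqP; rewrite eqEdim subvf dim_a leqnn.
exists tau, i0; split=> //.
- move=> x xA x0; have [P [mon_P DP]] := eP x.
  have := norm_prod_rmorph_ge1 DP x0 xA; rewrite -val_prod.
  by [].
- apply: val_inj; rewrite rmorphXn /= rmorph_nat.
  rewrite val_prod; have [P [mon_P DP]] := eP b.
  have DP' : \prod_(y <- [seq e i b | i <- enum 'I_(\dim {:K})]) ('X - y%:P) = map_poly ratr P.
    by rewrite big_map big_enum.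
  have [|k Dk szk] := prod_XsubC_minCpoly (x := iota b) mon_P DP'.
    by move=> _ /mapP[i _ ->]; rewrite -(minCpoly_rmorph (e i)) root_minCpoly.
  move: szk; rewrite size_map size_enum_ord size_minCpoly_rmorph Fadjoin_trace /= => szk.
  have -> : \dim_(<<1; c>>) {:K} = k by rewrite szk mulnK ?adim_gt0.
  rewrite -(norm_minCpoly_trace0 prim_zeta d_ge3) -iota_b -normrX -horner_exp -Dk.
  rewrite big_map big_enum /= horner_prod !normr_prod.
  by apply: eq_bigr => i _; rewrite !hornerE normrN.
by rewrite {1}dimK mulnCA dimF.
Qed.

End GroundField.

(** * Totients and the arithmetic of the table *)

Section NatBounds.
Local Open Scope nat_scope.

Lemma totient_ge_cube_coprime6 n : 0 < n -> ~~ (2 %| n) -> ~~ (3 %| n) ->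
  n ^ 3 <= totient n ^ 4.
Proof.
elim/ltn_ind: n => n IHn n_gt0 n2 n3.
have [n_le1|n_gt1] := leqP n 1.
  have -> : n = 1 by lia.
  by [].
set p := pdiv n; have p_pr : prime p by apply: pdiv_prime.
have p_dv : p %| n by apply: pdiv_dvd.
have p_ge5 : 5 <= p.
  have p_gt1 := prime_gt1 p_pr.
  have p4 : p != 4 by apply: contraTneq p_pr => ->.
  have p2 : p != 2 by apply: contraNneq n2 => <-.
  have p3 : p != 3 by apply: contraNneq n3 => <-.
  by lia.
have [m co_pm Dn] := pfactor_coprime p_pr n_gt0.
have e_gt0 : 0 < logn p n by rewrite logn_gt0 mem_primes p_pr n_gt0.
move: e_gt0 Dn; case: (logn p n) => // e _ Dn.
have m_gt0 : 0 < m by move: n_gt0; rewrite Dn; case: m {Dn co_pm}.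
have m_dv : m %| n by rewrite Dn dvdn_mulr.
have pe_gt1 : 1 < p ^ e.+1 by rewrite -(exp1n e.+1) ltn_exp2r // prime_gt1.
rewrite Dn totient_coprime ?coprimeXr 1?coprime_sym // totient_pfactor //=.
rewrite !expnMn leq_mul //.
  apply: IHn => //; first by rewrite Dn -[X in X < _]muln1 ltn_mul2l m_gt0.
    by apply: contra n2 => /dvdn_trans; apply.
  by apply: contra n3 => /dvdn_trans; apply.
rewrite [p ^ e.+1]expnS !expnMn leq_mul ?leq_pexp2l ?expn_gt0 ?prime_gt0 //.
by case: p p_ge5 {p_pr p_dv co_pm Dn pe_gt1} => // q q_ge4 /=; nia.
Qed.

Lemma totient_ge_cube n : 0 < n -> n ^ 3 <= 16 * totient n ^ 4.
Proof.
move=> n_gt0; have [m co2 Dn] := pfactor_coprime (isT : prime 2) n_gt0.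
have m_gt0 : 0 < m by move: n_gt0; rewrite Dn; case: m {Dn co2}.
have [k co3 Dm] := pfactor_coprime (isT : prime 3) m_gt0.
have k_gt0 : 0 < k by move: m_gt0; rewrite Dm; case: k {Dm co3}.
have k3 : ~~ (3 %| k) by rewrite -prime_coprime.
have k2 : ~~ (2 %| k).
  by rewrite -prime_coprime //; move: co2; rewrite Dm coprimeMr => /andP[].
have le_k := totient_ge_cube_coprime6 k_gt0 k2 k3.
set e := logn 2 n in Dn; set f := logn 3 m in Dm.
have le_2 : (2 ^ e) ^ 3 <= 8 * totient (2 ^ e) ^ 4.
  case: e {Dn} => [|e]; first by [].
  rewrite totient_pfactor //= mul1n [2 ^ e.+1]expnS expnMn leq_mul //.
  by rewrite leq_pexp2l ?expn_gt0.
have le_3 : 16 * (3 ^ f) ^ 3 <= 27 * totient (3 ^ f) ^ 4.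
  case: f {Dm} => [|f]; first by [].
  rewrite totient_pfactor //= [3 ^ f.+1]expnS !expnMn.
  have : (3 ^ f) ^ 3 <= (3 ^ f) ^ 4 by rewrite leq_pexp2l ?expn_gt0.
  by rewrite (_ : 3 ^ 3 = 27) // (_ : 2 ^ 4 = 16) //; lia.
have co_k3 : coprime k (3 ^ f) by rewrite coprimeXr // coprime_sym.
have co_m2 : coprime m (2 ^ e) by rewrite coprimeXr // coprime_sym.
rewrite Dn totient_coprime // Dm totient_coprime // !expnMn.
move: le_k le_2 le_3; move: (k ^ 3) (totient k ^ 4) ((2 ^ e) ^ 3) (totient (2 ^ e) ^ 4).
move: ((3 ^ f) ^ 3) (totient (3 ^ f) ^ 4) => x X y Y z Z le_y le_z le_x.
have le_yz := leq_mul le_y le_z; have := leq_mul le_yz le_x; nia.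
Qed.

Lemma of_nat_expn a b : N.of_nat (a ^ b) = N.pow (N.of_nat a) (N.of_nat b).
Proof. by elim: b => // b IHb; rewrite expnS Nat2N.inj_succ N.pow_succ_r' -IHb Nat2N.inj_mul.
  Qed.

Lemma leq_of_nat a b : (a <= b) = N.leb (N.of_nat a) (N.of_nat b).
Proof. by apply/idP/idP => [?|/N.leb_le ?]; [apply/N.leb_le|]; lia. Qed.

Lemma ltn_of_nat a b : (a < b) = N.ltb (N.of_nat a) (N.of_nat b).
Proof. by apply/idP/idP => [?|/N.ltb_lt ?]; [apply/N.ltb_lt|]; lia. Qed.

Definition table_bound (d : nat) : nat :=
  (head (d, 0) [seq x <- bound_table | x.1 == d]).2.

(* Certifies C / d^2 <= 4 sin^2(pi/d), see sine_bound_real. *)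
Definition small_sine_bound (d C : nat) : bool :=
  C ^ totient d * coprime_dist_prod d ^ 2 <= cyclotomic_at1 d ^ 2 * d ^ (2 * totient d).

(* Contradicts general_norm_bound below; 2 ^ 82 is 4 * 256 ^ 10. *)
Definition degree_excluded (d M C m : nat) : bool :=
  (5 ^ 5 * 2 ^ 82 * d ^ 20 * cyclotomic_at1 d ^ (10 * m) < 5 ^ (5 * (m * M)) * C ^ 10) &&
  (cyclotomic_at1 d ^ 2 <= 5 ^ M).

Lemma degree_excluded_mono d M C m m' : m <= m' -> degree_excluded d M C m -> degree_excluded
  d M C m'.
Proof.
rewrite /degree_excluded => le_m /andP[lt_m le_g]; rewrite le_g andbT.
have -> : m' = m + (m' - m) by rewrite subnKC.
move: (m' - m) (5 ^ 5 * 2 ^ 82 * d ^ 20) (C ^ 10) (cyclotomic_at1 d) lt_m le_g => j X Y g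
  lt_m le_g.
rewrite mulnDr expnD mulnDl mulnDr expnD mulnA [_ * 5 ^ _ * Y]mulnAC.
have lej : g ^ (10 * j) <= 5 ^ (5 * (j * M)).
  have -> : 10 * j = 2 * (5 * j) by lia.
  have -> : 5 * (j * M) = M * (5 * j) by lia.
  case: j => [|j]; first by rewrite ?mul0n !muln0.
  by rewrite [g ^ _]expnM [5 ^ _]expnM leq_exp2r ?muln_gt0.
apply: leq_ltn_trans (leq_mul (leqnn _) lej) _.
by rewrite ltn_mul2r expn_gt0 lt_m.
Qed.

Definition coprime_dist_prodN (d : nat) : N :=
  foldr (fun k x => if coprime k d then (N.of_nat (minn k (d - k)) * x)%num else x) 1%num
        (iota 0 d).

Lemma coprime_dist_prodNE d : N.of_nat (coprime_dist_prod d) = coprime_dist_prodN d.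
Proof.
rewrite /coprime_dist_prod -(big_mkord (fun k => coprime k d) (fun k => minn k (d - k))).
rewrite /index_iota subn0 /coprime_dist_prodN; elim: (iota 0 d) => [|k s IHs] /=.
  by rewrite big_nil.
by rewrite big_cons; case: ifP => _ //; rewrite Nat2N.inj_mul IHs.
Qed.

Lemma leq_monomialN a i b j c k e l :
  ((N.of_nat a ^ N.of_nat i * N.of_nat b ^ N.of_nat j
     <=? N.of_nat c ^ N.of_nat k * N.of_nat e ^ N.of_nat l)%num) =
  (a ^ i * b ^ j <= c ^ k * e ^ l).
Proof. by rewrite -!of_nat_expn -!Nat2N.inj_mul leq_of_nat. Qed.

Lemma ltn_monomialN a i b j c k e l f m g n :
  ((N.of_nat a ^ N.of_nat i * N.of_nat b ^ N.of_nat j * N.of_nat c ^ N.of_nat k * N.of_nat e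
    ^ N.of_nat l
     <? N.of_nat f ^ N.of_nat m * N.of_nat g ^ N.of_nat n)%num) =
  (a ^ i * b ^ j * c ^ k * e ^ l < f ^ m * g ^ n).
Proof. by rewrite -!of_nat_expn -!Nat2N.inj_mul ltn_of_nat. Qed.

Lemma ltn_monomialN1 a i b j c k f m :
  ((N.of_nat a ^ N.of_nat i * N.of_nat b ^ N.of_nat j * N.of_nat c ^ N.of_nat k
     <? N.of_nat f ^ N.of_nat m)%num) =
  (a ^ i * b ^ j * c ^ k < f ^ m).
Proof. by rewrite -!of_nat_expn -!Nat2N.inj_mul ltn_of_nat. Qed.

Lemma leq_expN2 a i b j c k :
  ((N.of_nat a ^ N.of_nat i <=? N.of_nat b ^ N.of_nat j * N.of_nat c ^ N.of_nat k)%num) =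
  (a ^ i <= b ^ j * c ^ k).
Proof. by rewrite -!of_nat_expn -!Nat2N.inj_mul leq_of_nat. Qed.

Lemma leq_expN a i b j :
  ((N.of_nat a ^ N.of_nat i <=? N.of_nat b ^ N.of_nat j)%num) = (a ^ i <= b ^ j).
Proof. by rewrite -!of_nat_expn leq_of_nat. Qed.

Definition range_check (d : nat) : bool :=
  let phi := totient d in
  if (64 <= phi) || (d \in [:: 3; 4; 5; 7]) then true else
  let M := phi./2 in let b := table_bound d in
  let g := N.of_nat (cyclotomic_at1 d) in let D := N.of_nat d in
  (N.of_nat 25 ^ N.of_nat phi * coprime_dist_prodN d ^ N.of_nat 2
     <=? g ^ N.of_nat 2 * D ^ N.of_nat (2 * phi))%num &&
  ((N.of_nat 5 ^ N.of_nat 5 * N.of_nat 2 ^ N.of_nat 82 * D ^ N.of_nat 20 * g ^ N.of_nat (10 *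
    b.+1)
     <? N.of_nat 5 ^ N.of_nat (5 * (b.+1 * M)) * N.of_nat 25 ^ N.of_nat 10)%num &&
  (g ^ N.of_nat 2 <=? N.of_nat 5 ^ N.of_nat M)%num).

Lemma range_check_all : all range_check (iota 3 616).
Proof. by vm_compute. Qed.

Lemma range_checkP d : range_check d -> totient d < 64 -> d \notin [:: 3; 4; 5; 7] ->
  small_sine_bound d 25 /\ degree_excluded d (totient d)./2 25 (table_bound d).+1.
Proof.
rewrite /range_check leqNgt => chk phi_lt not_special.
rewrite phi_lt (negPf not_special) in chk; case/andP: chk => c1 c23.
rewrite -coprime_dist_prodNE leq_monomialN in c1.
by rewrite ltn_monomialN leq_expN in c23; split.
Qed.

Lemma cyclotomic_at1_bounds d : 1 < d -> 0 < cyclotomic_at1 d <= d.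
Proof.
move=> d_gt1; rewrite /cyclotomic_at1; case Dps: (primes d) => [|p [|q ps]];
  rewrite ?(ltnW d_gt1) //.
have : p \in primes d by rewrite Dps mem_head.
rewrite mem_primes => /and3P[p_pr d_gt0 p_d].
by rewrite prime_gt0 // dvdn_leq.
Qed.

Lemma coprime_dist_prod_gt0 d : 1 < d -> 0 < coprime_dist_prod d.
Proof.
move=> d_gt1; apply: prodn_cond_gt0 => k co_kd; rewrite leq_min subn_gt0 ltn_ord andbT lt0n.
by apply: contraTneq co_kd => ->; rewrite /coprime gcd0n; lia.
Qed.

Lemma small_sine_bound4 d : 1 < d -> small_sine_bound d 4.
Proof.
move=> d_gt1; have /andP[g_gt0 _] := cyclotomic_at1_bounds d_gt1.
have le_P : 2 ^ totient d * coprime_dist_prod d <= d ^ totient d.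
  have card : totient d = #|[pred k : 'I_d | coprime k d]|.
    rewrite totient_count_coprime -big_mkcond big_mkord -sum1_card.
    by apply: eq_bigl => k; rewrite coprime_sym.
  rewrite card -!prod_nat_const -big_split /=; apply: leq_prod => k _.
  by have := ltn_ord k; lia.
rewrite /small_sine_bound -[4]/(2 ^ 2) -expnM [2 * _]mulnC !expnM -expnMn.
have sq : (2 ^ totient d * coprime_dist_prod d) ^ 2 <= (d ^ totient d) ^ 2 by rewrite leq_exp2r.
by apply: leq_trans sq _; rewrite leq_pmull // expn_gt0 g_gt0.
Qed.

Lemma leq_exp_ratio A B C x y k : 0 < A -> A * x <= B * y -> B ^ k <= A ^ k * C ->
  x ^ k <= C * y ^ k.
Proof.
move=> A_gt0 le_xy le_BA; have Ak_gt0 : 0 < A ^ k by rewrite expn_gt0 A_gt0.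
rewrite -(leq_pmul2l Ak_gt0) mulnA -expnMn.
case: k le_BA {Ak_gt0} => [|k] le_BA; first by rewrite !expn0 muln1 in le_BA *.
apply: (@leq_trans ((B * y) ^ k.+1)); first by rewrite leq_exp2r.
by rewrite expnMn leq_mul2r le_BA orbT.
Qed.

Lemma exp5_growth_step M : 32 <= M -> M.+1 ^ 40 <= 5 ^ 5 * M ^ 40.
Proof.
move=> M_ge; apply: (@leq_exp_ratio 5 6); [by []|lia|].
by rewrite -leq_expN2; vm_compute.
Qed.

Lemma exp5_growth_from C M : 32 <= M -> C * 32 ^ 40 < 5 ^ (5 * 32) -> C * M ^ 40 < 5 ^ (5 * M).
Proof.
move=> M_ge; rewrite -(subnKC M_ge); elim: (M - 32) => [|j IHj] base; first by rewrite addn0.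
have step := exp5_growth_step (leq_addr j 32).
rewrite addnS mulnS expnD; apply: leq_ltn_trans (_ : 5 ^ 5 * (C * (32 + j) ^ 40) < _).
  by rewrite mulnCA leq_mul2l step orbT.
by rewrite ltn_mul2l IHj // expn_gt0.
Qed.

Lemma exp5_growth M : 32 <= M -> 5 ^ 5 * 2 ^ 142 * M ^ 40 < 5 ^ (5 * M).
Proof.
move=> M_ge; apply: exp5_growth_from M_ge _.
by rewrite -ltn_monomialN1; vm_compute.
Qed.

Lemma cube_bound_pow d g M j : g <= d -> d ^ 3 <= 2 ^ 8 * M ^ 4 ->
  d ^ (2 * j) * g ^ j <= 2 ^ (8 * j) * M ^ (4 * j).
Proof.
case: j => [|j] le_gd le_d3; first by rewrite !muln0.
apply: (@leq_trans (d ^ (2 * j.+1) * d ^ j.+1)).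
  by rewrite leq_mul2l leq_exp2r // le_gd orbT.
by rewrite -expnD -{2}[j.+1]mul1n -mulnDl !expnM -expnMn leq_exp2r.
Qed.

Lemma leq_ltn_mul_chain T U V W S x y z :
  0 < S -> x <= V * y -> T * V = W * S -> U * W * y < z -> U * T * x < z * S.
Proof.
move=> S_gt0 le_x TV lt_z; apply: (@leq_ltn_trans (U * W * y * S));
  last by rewrite ltn_mul2r S_gt0.
have -> : U * W * y * S = U * T * (V * y) by rewrite mulnAC -[U * W * S]mulnA -TV !mulnA.
by rewrite leq_mul2l le_x orbT.
Qed.

Lemma expn24_split i j k l : i + j = k + 2 * l -> 2 ^ i * 2 ^ j = 2 ^ k * 4 ^ l.
Proof. by move=> eq_ij; rewrite -expnD eq_ij expnD expnM. Qed.

Lemma leq_expn_factor g d j M i k l : 0 < d -> 0 < l -> d ^ i * g ^ (2 * j) <= l ->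
  l < M ^ (k * j) -> 0 < j -> g ^ 2 <= M ^ k.
Proof.
move=> d_gt0 l_gt0 le_l lt_l j_gt0.
have : g ^ (2 * j) <= M ^ (k * j).
  by apply: leq_trans (leq_trans _ le_l) (ltnW lt_l); rewrite leq_pmull // expn_gt0 d_gt0.
by rewrite !expnM leq_exp2r.
Qed.

Lemma large_field_cube d M : 1 < d -> totient d = 2 * M -> d ^ 3 <= 2 ^ 8 * M ^ 4.
Proof.
move=> d_gt1 phi_d; apply: leq_trans (totient_ge_cube (ltnW d_gt1)) _.
by rewrite phi_d expnMn mulnA.
Qed.

Lemma degree_excluded_large_main d g M : g <= d -> d ^ 3 <= 2 ^ 8 * M ^ 4 -> 32 <= M ->
  5 ^ 5 * 2 ^ 82 * (d ^ 20 * g ^ 10) < 5 ^ (5 * M) * 4 ^ 10.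
Proof.
move=> g_le le_d3 M_ge.
apply: leq_ltn_mul_chain (cube_bound_pow 10 g_le le_d3) (expn24_split _) (exp5_growth M_ge).
  by rewrite expn_gt0.
by [].
Qed.

Lemma sqr_le_exp5 C V d g M : 0 < C -> V <= C -> 0 < d -> 0 < M ->
  d ^ 20 * g ^ 10 <= V * M ^ 40 -> C * M ^ 40 < 5 ^ (5 * M) -> g ^ 2 <= 5 ^ M.
Proof.
move=> C_gt0 le_VC d_gt0 M_gt0 le_d30 lt5; rewrite [5 * M]mulnC in lt5.
apply: (@leq_expn_factor _ d 5 5 20 M (C * M ^ 40) d_gt0 _ (leq_trans le_d30 _) lt5) => //.
  by rewrite muln_gt0 C_gt0 expn_gt0 M_gt0.
by rewrite leq_mul2r le_VC orbT.
Qed.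

Lemma degree_excluded_large_sqr d g M : 0 < d -> g <= d -> d ^ 3 <= 2 ^ 8 * M ^ 4 -> 32 <= M ->
  g ^ 2 <= 5 ^ M.
Proof.
move=> d_gt0 g_le le_d3 M_ge; have M_gt0 : 0 < M by apply: leq_trans M_ge.
apply: (sqr_le_exp5 _ _ d_gt0 M_gt0 (cube_bound_pow 10 g_le le_d3) (exp5_growth M_ge)).
  by rewrite muln_gt0 !expn_gt0.
by rewrite -leq_expN2; vm_compute.
Qed.

Lemma degree_excluded_large d M : 1 < d -> totient d = 2 * M -> 32 <= M -> degree_excluded d
  M 4 1.
Proof.
move=> d_gt1 phi_d M_ge; have /andP[_ g_le] := cyclotomic_at1_bounds d_gt1.
have le_d3 := large_field_cube d_gt1 phi_d.
rewrite /degree_excluded muln1 mul1n -mulnA degree_excluded_large_main //=.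
exact: degree_excluded_large_sqr (ltnW d_gt1) g_le le_d3 M_ge.
Qed.

Lemma not_special_dim_bound d : 2 < d -> d \notin [:: 3; 4; 5; 7] -> ~~ odd (totient d) ->
  exists C, [/\ 0 < C, small_sine_bound d C & degree_excluded d (totient d)./2 C (table_bound
    d).+1].
Proof.
move=> d_gt2 not_special phi_even; have d_gt1 := ltnW d_gt2.
have phi_d : totient d = 2 * (totient d)./2
  by rewrite -{1}[totient d]odd_double_half (negPf phi_even) mul2n.
have [M_ge|M_lt] := leqP 32 (totient d)./2.
  exists 4; split=> //; first exact: small_sine_bound4.
  apply: degree_excluded_mono (degree_excluded_large d_gt1 phi_d M_ge) => //.
have d_lt : d < 619.
  rewrite ltnNge; apply/negP => d_ge.
  have := totient_ge_cube (ltnW d_gt1); rewrite phi_d expnMn leqNgt => /negP[].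
  apply: (@leq_trans (619 ^ 3)); last by rewrite leq_exp2r.
  apply: (@leq_ltn_trans (2 ^ 4 * 2 ^ 4 * 31 ^ 4)).
    by rewrite -mulnA leq_mul2l; apply/orP; right; rewrite leq_mul2l leq_exp2r //; lia.
  by rewrite -ltn_monomialN1; vm_compute.
have [||c1 c2] := @range_checkP d _ _ not_special.
- by apply: (allP range_check_all); rewrite mem_iota; lia.
- by rewrite phi_d; lia.
by exists 25; split.
Qed.

End NatBounds.

(** * Sup norms of the auxiliary polynomials *)

Section RealBounds.
Variable R : realFieldType.
Implicit Types (x y z t v : R).

Lemma prod_seq_AGM (s : seq R) (S : R) : {in s, forall x, 0 <= x} ->
  \sum_(x <- s) x <= S * (size s)%:R -> \prod_(x <- s) x <= S ^+ size s.
Proof.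
move=> s_ge0 le_sum; have [s0|s_gt0] := posnP (size s).
  by rewrite (size0nil s0) big_nil expr0.
have n_gt0 : (0 : R) < (size s)%:R by rewrite ltr0n.
have [+ _] := @leif_AGM R 'I_(size s) predT (fun i => s`_i) (fun i _ => s_ge0 _ (mem_nth 0
  (ltn_ord i))).
rewrite card_ord -!(big_mkord predT (fun i => s`_i)) -!(big_nth 0 predT id) => le_prod.
have sum_ge0 : 0 <= \sum_(x <- s) x by rewrite big_seq sumr_ge0.
apply: le_trans le_prod _; rewrite lerXn2r ?nnegrE ?divr_ge0 ?ler0n //.
  by rewrite -(pmulr_lge0 _ n_gt0) (le_trans sum_ge0).
by rewrite ler_pdivrMr.
Qed.

Lemma weighted_AGM x y z (i j k : nat) (S : R) : 0 <= x -> 0 <= y -> 0 <= z ->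
  i%:R * x + j%:R * y + k%:R * z <= S * (i + j + k)%:R ->
  x ^+ i * y ^+ j * z ^+ k <= S ^+ (i + j + k).
Proof.
move=> x0 y0 z0; rewrite !mulr_natl => le_sum.
have := @prod_seq_AGM (nseq i x ++ nseq j y ++ nseq k z) S.
rewrite !size_cat !size_nseq !big_cat /= !big_nseq !iter_addr_0 !iter_mulr_1.
rewrite addnA mulrA addrA; apply=> // u.
by rewrite !mem_cat !mem_nseq => /or3P[] /andP[_ /eqP->].
Qed.

(* Equality holds at t = 1/5; the bound is the maximum. *)
Lemma quintic_bound t : 0 < t -> t <= 1/4 -> `|t ^+ 4 * (1 - 4 * t)| <= 1/3125.
Proof.
move=> t0 t1; have f0 : 0 <= t ^+ 4 * (1 - 4 * t) by rewrite mulr_ge0 ?exprn_ge0 //; lra.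
have AGM : (5 * t) ^+ 4 * (5 * (1 - 4 * t)) ^+ 1 * 1 ^+ 0 <= 1 ^+ (4 + 1 + 0).
  by apply: weighted_AGM; lra.
by rewrite ger0_norm //; lra.
Qed.

Lemma quadratic_bound4 t : 0 < t -> t <= 1/4 -> `|4 * t * (1 - 4 * t)| <= 1/4.
Proof.
move=> t0 t1; have sq := sqr_ge0 (1 - 8 * t).
by rewrite ger0_norm ?mulr_ge0 //; lra.
Qed.

Lemma quadratic_bound5 t : 0 < t -> t <= 1/4 -> `|t * (5 * t - 1)| <= 1/16.
Proof.
move=> t0 t1; have sq := sqr_ge0 (1 - 10 * t).
have p := mulr_ge0 (ltW t0) (_ : 0 <= 1/4 - t).
by rewrite ler_norml; apply/andP; split; [lra|have := p ltac:(lra); lra].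
Qed.

(* For t >= 1/7 the weights make the AM-GM sum constant and nearly balanced at
   the maximum t = (33 + sqrt 193) / 224. *)
Lemma quartic_bound7 t : 0 < t -> t <= 1/4 ->
  `|t ^+ 2 * (1 - 4 * t) * (7 * t - 1)| <= 1/300.
Proof.
move=> t0 t1; have [t7|t7] := lerP t (1/7).
  have -> : t ^+ 2 * (1 - 4 * t) * (7 * t - 1) = - ((t * (1 - 4 * t)) * (t * (1 - 7 * t)))
    by ring.
  rewrite normrN normrM.
  have sq1 := sqr_ge0 (1 - 8 * t); have sq2 := sqr_ge0 (1 - 14 * t).
  have b1 : `|t * (1 - 4 * t)| <= 1/16 by rewrite ger0_norm ?mulr_ge0 //; lra.
  have b2 : `|t * (1 - 7 * t)| <= 1/28 by rewrite ger0_norm ?mulr_ge0 //; lra.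
  by apply: le_trans (ler_pM _ _ b1 b2) _ => //; lra.
have AGM : (49 * t) ^+ 2 * (63 * (1 - 4 * t)) ^+ 1 * (22 * (7 * t - 1)) ^+ 1 <= (41/4) ^+ (2
  + 1 + 1).
  by apply: weighted_AGM; lra.
have t2 : 0 <= t ^+ 2 * (1 - 4 * t) * (7 * t - 1).
  by rewrite !mulr_ge0 ?exprn_ge0 //; lra.
by rewrite ger0_norm //; lra.
Qed.

(* In v = 1 - s the polynomial is -v^3 (1 - v)^3 (1 + v)^4, maximal at v = 3/5. *)
Lemma decic_bound3 (s : R) : 0 < s -> s <= 9/4 ->
  `|s ^+ 3 * (s - 1) ^+ 3 * (s - 2) ^+ 4| <= 1/11.
Proof.
move=> s0 s1; pose v := 1 - s; have sE : s = 1 - v by rewrite /v; ring.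
have -> : s ^+ 3 * (s - 1) ^+ 3 * (s - 2) ^+ 4 = - ((v * (1 - v) * (1 + v)) ^+ 3 * (1 + v)).
  by rewrite sE; ring.
have v_lt1 : v < 1 by rewrite /v; lra.
have v_ge : -5/4 <= v by rewrite /v; lra.
rewrite normrN; have [v0|v0] := lerP 0 v.
  have AGM : (5/3 * v) ^+ 3 * (5/2 * (1 - v)) ^+ 3 * (5/8 * (1 + v)) ^+ 4 <= 1 ^+ (3 + 3 + 4).
    by apply: weighted_AGM; lra.
  have f0 : 0 <= (v * (1 - v) * (1 + v)) ^+ 3 * (1 + v).
    by rewrite !mulr_ge0 ?exprn_ge0 ?mulr_ge0 //; lra.
  by rewrite ger0_norm //; lra.
rewrite normrM normrX; have [vm1|vm1] := lerP (-1) v.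
  have w : `|v * (1 - v) * (1 + v)| <= 2/5.
    have c1 : 0 <= (v + 4/7) ^+ 2 * (8/7 - v) by rewrite mulr_ge0 ?sqr_ge0 //; lra.
    have c2 : 0 <= - v * (1 - v) * (1 + v) by rewrite !mulr_ge0 //; lra.
    by rewrite ler_norml; apply/andP; split; lra.
  have w3 : `|v * (1 - v) * (1 + v)| ^+ 3 <= (2/5) ^+ 3 by rewrite lerXn2r ?nnegrE //; lra.
  have u : `|1 + v| <= 1 by rewrite ger0_norm; lra.
  by apply: le_trans (ler_pM _ _ w3 u) _; rewrite ?exprn_ge0 //; lra.
have w : `|v * (1 - v) * (1 + v)| <= 5/4 * (9/16).
  have c1 : 0 <= (5/4 + v) * (v ^+ 2 - 5/4 * v + 9/16).
    by apply: mulr_ge0; [lra|have := sqr_ge0 v; lra].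
  have c2 : 0 <= - v * (1 - v) * - (1 + v) by rewrite !mulr_ge0 //; lra.
  by rewrite ler_norml; apply/andP; split; lra.
have w3 : `|v * (1 - v) * (1 + v)| ^+ 3 <= (5/4 * (9/16)) ^+ 3 by rewrite lerXn2r ?nnegrE //;
  lra.
have u : `|1 + v| <= 1/4 by rewrite ler0_norm; lra.
by apply: le_trans (ler_pM _ _ w3 u) _; rewrite ?exprn_ge0 //; lra.
Qed.
End RealBounds.

(** * Degree bounds *)

Lemma prod_norm_le (R : realDomainType) n (u : 'I_n -> R) i0 rho R0 :
    (forall i, i != i0 -> `|u i| <= rho) -> `|u i0| <= R0 ->
  \prod_i `|u i| <= R0 * rho ^+ n.-1.
Proof.
move=> u_le u0_le; rewrite (bigD1 i0) //=; apply: ler_pM => //.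
  by apply: prodr_ge0 => i _; apply: normr_ge0.
have -> : rho ^+ n.-1 = \prod_(i < n | i != i0) rho.
  by rewrite prodr_const cardC1 card_ord.
by apply: ler_prod => i ne_i; rewrite normr_ge0 u_le.
Qed.

Lemma leq_monomial_natr (R : numDomainType) a i b j c k e l f p :
  (a ^ i * b ^ j <= c ^ k * e ^ l * f ^ p)%N =
  (a%:R ^+ i * b%:R ^+ j <= c%:R ^+ k * e%:R ^+ l * f%:R ^+ p :> R).
Proof. by rewrite -(ler_nat R) !natrM !natrX. Qed.

Lemma leq_mul_cancel p x y z u v : (x * y <= z * u * v)%N -> (p * x * y <= p * z * u * v)%N.
Proof. by move=> le_xy; rewrite -!mulnA !leq_mul2l !mulnA le_xy orbT. Qed.

Lemma scheme_natr (R : numFieldType) (n e k m g c y r : nat) : (0 < n)%N -> (0 < r)%N ->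
    1 <= g%:R ^+ (m * k) * (c%:R * y%:R ^+ e * (1 / r%:R) ^+ n.-1) :> R ->
  (r ^ n <= g ^ (m * k) * (c * y ^ e) * r)%N.
Proof.
move=> n_gt0 r_gt0; have rn_gt0 : 0 < r%:R ^+ n.-1 :> R by rewrite exprn_gt0 ?ltr0n.
rewrite div1r exprVn !mulrA ler_pdivlMr // mul1r -!natrX -!natrM ler_nat => le_r.
by rewrite -{1}(prednK n_gt0) expnSr leq_mul2r mulnA le_r orbT.
Qed.

Lemma geometric_bound (p q X m0 m : nat) : (0 < p)%N -> (q <= p)%N -> (q ^ m0 * X < p ^ m0)%N ->
  (p ^ m <= q ^ m * X)%N -> (m < m0)%N.
Proof.
move=> p_gt0 le_qp lt_m0 le_m; rewrite ltnNge; apply/negP => le_m0m.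
have := leq_ltn_trans le_m; rewrite -(subnKC le_m0m) !expnD => /(_ (p ^ m0 * p ^ (m - m0)))%N.
rewrite ltnn => H; apply/negP/H: isT; rewrite mulnAC.
have le_j : (q ^ (m - m0) <= p ^ (m - m0))%N.
  by case: (m - m0)%N => // j; rewrite leq_exp2r.
apply: leq_ltn_trans (leq_mul (leqnn _) le_j) _.
by rewrite ltn_mul2r lt_m0 expn_gt0 p_gt0.
Qed.

Lemma scheme_bound (R : numFieldType) (n M e k m g c y r m0 : nat) :
    (0 < n)%N -> n = (M * m)%N -> (0 < r)%N ->
    1 <= g%:R ^+ (m * k) * (c%:R * y%:R ^+ e * (1 / r%:R) ^+ n.-1) :> R ->
    (g ^ k <= r ^ M)%N -> (g ^ (k * m0) * c ^ 1 * y ^ e * r ^ 1 < r ^ (M * m0) * 1 ^ 0)%N ->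
  (m < m0)%N.
Proof.
move=> n_gt0 Dn r_gt0 /(scheme_natr n_gt0 r_gt0); rewrite Dn mulnC => le_r le_g.
rewrite !expn1 exp1n muln1 !expnM -!mulnA => lt_m0.
apply: geometric_bound le_g lt_m0 _; first by rewrite expn_gt0 r_gt0.
by move: le_r; rewrite mulnC [(m * k)%N]mulnC !expnM -!mulnA.
Qed.

Lemma root5_ge (R : realFieldType) (x : R) : x ^+ 2 - 5 * x + 5 = 0 -> 13/10 <= x.
Proof.
move=> x5; rewrite leNgt; apply/negP => x_lt.
have p : 0 < (13/10 - x) * (37/10 - x) by apply: mulr_gt0; lra.
by lra.
Qed.

Lemma root7_ge (R : realFieldType) (x : R) :
  0 < x -> x ^+ 3 - 7 * x ^+ 2 + 14 * x - 7 = 0 -> 64/100 <= x.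
Proof.
move=> x_gt0 x7; rewrite leNgt; apply/negP => x_lt.
have p1 : 0 < (64/100 - x) * (64/100 - x) by apply: mulr_gt0; lra.
have p2 : 0 < (64/100 - x) * (x * x) by rewrite mulr_gt0 ?mulr_gt0 //; lra.
by lra.
Qed.

Section NormEstimates.

Variables (K : fieldExtType rat) (iota : {rmorphism K -> algC}) (a b : K) (n m g : nat).
Variables (tau : 'I_n -> {rmorphism K -> algR}) (i0 : 'I_n).
Hypothesis tau_conj : forall i, i != i0 -> 0 < tau i a < tau i b.
Hypothesis norm_ge1 : forall x, iota x \in Aint -> x != 0 -> 1 <= `|\prod_i tau i x|.
Hypothesis norm_b : `|\prod_i tau i b| = g%:R ^+ m.
Hypothesis aA : iota a \in Aint.
Hypothesis bA : iota b \in Aint.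
Hypothesis a_gt4 : 4 < tau i0 a.
Hypothesis a_lt : tau i0 a < 256.
Hypothesis b_gt0 : 0 < tau i0 b.
Hypothesis b_le4 : tau i0 b <= 4.

Let t_ i : algR := tau i a / tau i b * (1 - tau i a / tau i b).

Lemma norm_scheme (Y : algR) (x : K) (k : nat) (f : algR -> algR) (rho R0 : algR) :
    256 <= Y * tau i0 b ->
    iota x \in Aint -> (forall i, tau i x = tau i b ^+ k * f (t_ i)) ->
    (forall t, 0 < t -> t <= 1/4 -> `|f t| <= rho) ->
    (forall t, t < 0 -> - t <= Y ^+ 2 - Y -> f t != 0 /\ `|f t| <= R0) ->
  1 <= g%:R ^+ (m * k) * (R0 * rho ^+ n.-1).
Proof.
move=> leY xA xE f_rho f_R0.
have t_small i : i != i0 -> 0 < t_ i /\ t_ i <= 1/4.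
  move=> /tau_conj/andP[a0 ab]; have b0 := lt_trans a0 ab.
  have y0 : 0 < tau i a / tau i b by rewrite divr_gt0.
  have y1 : tau i a / tau i b < 1 by rewrite ltr_pdivrMr // mul1r.
  rewrite /t_; move: (tau i a / tau i b) y0 y1 => y y0 y1.
  have sq := sqr_ge0 (1 - 2 * y); split; last by lra.
  by rewrite mulr_gt0 // subr_gt0.
have t0_neg : t_ i0 < 0 /\ - t_ i0 <= Y ^+ 2 - Y.
  have y1 : 1 < tau i0 a / tau i0 b by rewrite ltr_pdivlMr // mul1r (le_lt_trans b_le4).
  have yY : tau i0 a / tau i0 b <= Y by rewrite ler_pdivrMr // (le_trans (ltW a_lt)).
  rewrite /t_; move: (tau i0 a / tau i0 b) y1 yY => y y1 yY.
  have p1 : 0 < y * (y - 1) by rewrite mulr_gt0; lra.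
  have p2 : 0 <= (Y - y) * (Y + y - 1) by rewrite mulr_ge0; lra.
  by split; lra.
have [f0 f_le] := f_R0 _ t0_neg.1 t0_neg.2.
have x0 : x != 0.
  rewrite -(fmorph_eq0 (tau i0)) xE mulf_eq0 negb_or f0 andbT.
  by rewrite expf_neq0 // gt_eqF.
apply: le_trans (norm_ge1 xA x0) _.
rewrite (eq_bigr _ (fun i _ => xE i)) big_split /= prodrXl normrM normrX norm_b -exprM.
apply: ler_wpM2l; first by rewrite exprn_ge0 ?ler0n.
rewrite normr_prod; apply: prod_norm_le f_le => i /t_small[ti0 ti1]; exact: f_rho.
Qed.

Lemma general_norm_bound (d C : nat) : (0 < C)%N -> (0 < d)%N ->
    C%:R <= tau i0 b * d%:R ^+ 2 ->
  (5 ^ (5 * n) * C ^ 10 <= 5 ^ 5 * 2 ^ 82 * d ^ 20 * g ^ (10 * m))%N.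
Proof.
move=> C_gt0 d_gt0 le_b.
have n_gt0 : (0 < n)%N by case: (n) i0 => // -[].
have C0 : 0 < C%:R :> algR by rewrite ltr0n.
have d0 : 0 < d%:R :> algR by rewrite ltr0n.
pose Y : algR := 256 * d%:R ^+ 2 / C%:R.
have leY : 256 <= Y * tau i0 b.
  rewrite /Y mulrAC ler_pdivlMr // -mulrA ler_pM2l; last by lra.
  by rewrite mulrC.
pose x := (a * (b - a)) ^+ 4 * (b ^+ 2 - 4 * (a * (b - a))).
have xA : iota x \in Aint.
  by rewrite /x !(rmorphM, rmorphXn, rmorphB, rmorph_nat) !(rpredM, rpredX, rpredB, rpred_nat).
have bi0 i : tau i b != 0.
  have [->|/tau_conj/andP[ai ab]] := eqVneq i i0; first by rewrite gt_eqF.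
  by rewrite gt_eqF // (lt_trans ai).
have Y1 : 1 <= Y.
  rewrite -(ler_pM2r b_gt0) mul1r (le_trans b_le4) // (le_trans _ leY) //; lra.
have scheme : 1 <= g%:R ^+ (m * 10) * (4 * Y ^+ 10 * (1/3125) ^+ n.-1).
  apply: (@norm_scheme Y x 10 (fun t => t ^+ 4 * (1 - 4 * t))) => //.
  - move=> i; rewrite /t_ /x !(rmorphM, rmorphXn, rmorphB, rmorph_nat).
    by field; apply: bi0.
  - by move=> t; apply: quintic_bound.
  move=> t t_lt0 t_ge /=; have f1 : 0 < 1 - 4 * t by lra.
  split; first by rewrite mulf_neq0 ?expf_neq0 ?(lt_eqF t_lt0) ?(gt_eqF f1).
  rewrite normrM normrX (gtr0_norm f1) (ltr0_norm t_lt0).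
  have tY : - t <= Y ^+ 2 by lra.
  have t4 : (- t) ^+ 4 <= (Y ^+ 2) ^+ 4 by rewrite lerXn2r ?nnegrE ?exprn_ge0 //; lra.
  have -> : 4 * Y ^+ 10 = (Y ^+ 2) ^+ 4 * (4 * Y ^+ 2) by ring.
  by apply: ler_pM => //; rewrite ?exprn_ge0 //; lra.
have {}scheme : 5 ^+ (5 * n.-1) * C%:R ^+ 10 <= 2 ^+ 82 * d%:R ^+ 20 * g%:R ^+ (10 * m) :> algR.
  have C10 : 0 < C%:R ^+ 10 :> algR by rewrite exprn_gt0.
  have p5 : 0 < 5 ^+ (5 * n.-1) :> algR by rewrite exprn_gt0.
  have := ler_wpM2l (ltW (mulr_gt0 p5 C10)) scheme; rewrite mulr1 => /le_trans; apply.
  have e5 : 5 ^+ (5 * n.-1) = 3125 ^+ n.-1 :> algR by rewrite exprM; congr (_ ^+ _); ring.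
  have e2 : 2 ^+ 82 = 4 * 256 ^+ 10 :> algR by ring.
  rewrite le_eqVlt; apply/orP; left; apply/eqP.
  have eY : Y ^+ 10 = 256 ^+ 10 * d%:R ^+ 20 / C%:R ^+ 10 by rewrite /Y 2!exprMn exprVn -exprM.
  rewrite e5 e2 eY [(10 * m)%N]mulnC div1r exprVn.
  move: (3125 ^+ n.-1) (256 ^+ 10) (C%:R ^+ 10) p5 C10 e5 => u v w p5 C10 e5.
  by field; rewrite -e5 !gt_eqF.
have e5n : (5 ^ (5 * n) = 5 ^ 5 * 5 ^ (5 * n.-1))%N by rewrite -expnD -mulnS prednK.
by rewrite e5n leq_mul_cancel // (@leq_monomial_natr algR).
Qed.

Let n_gt0 : (0 < n)%N.
Proof. by case: (n) i0 => // -[]. Qed.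

Lemma degree_bound3 : b = 3 -> n = m -> (m < 48)%N.
Proof.
move=> b3 Dn; pose s := a * (3 - a).
pose f (t : algR) := (9 * t) ^+ 3 * (9 * t - 1) ^+ 3 * (9 * t - 2) ^+ 4.
have tb i : tau i b = 3 by rewrite b3 rmorph_nat.
have Dn' : n = (1 * m)%N by rewrite mul1n.
apply: (@scheme_bound algR n 1 20 0 m g 1 257 11 _ n_gt0 Dn' isT).
- apply: (@norm_scheme (256/3) (s ^+ 3 * (s - 1) ^+ 3 * (s - 2) ^+ 4) 0 f).
  + by rewrite tb; lra.
  + by rewrite /s !(rmorphM, rmorphXn, rmorphB, rmorph_nat, rmorph1) !(rpredM, rpredX,
    rpredB, rpred_nat, rpred1).
  + move=> i; rewrite /f /t_ /s !(rmorphM, rmorphXn, rmorphB, rmorph_nat, rmorph1) tb.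
    by field.
  + by move=> t t0 t1; apply: decic_bound3; lra.
  move=> t t0 t1; rewrite /f; split.
    have n1 : 9 * t != 0 by rewrite lt_eqF //; lra.
    have n2 : 9 * t - 1 != 0 by rewrite lt_eqF //; lra.
    have n3 : 9 * t - 2 != 0 by rewrite lt_eqF //; lra.
    by apply: mulf_neq0; [apply: mulf_neq0|]; apply: expf_neq0.
  have le1 : `|9 * t| <= 257 ^+ 2 by rewrite ltr0_norm; lra.
  have le2 : `|9 * t - 1| <= 257 ^+ 2 by rewrite ltr0_norm; lra.
  have le3 : `|9 * t - 2| <= 257 ^+ 2 by rewrite ltr0_norm; lra.
  have -> : 1%:R * 257%:R ^+ 20 = (257 ^+ 2) ^+ 3 * (257 ^+ 2) ^+ 3 * (257 ^+ 2) ^+ 4 :> algR.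
    by rewrite mul1r -!exprM -!exprD.
  rewrite 2!normrM !normrX; apply: ler_pM; rewrite ?mulr_ge0 ?exprn_ge0 //.
    by apply: ler_pM; rewrite ?exprn_ge0 // lerXn2r ?nnegrE ?exprn_ge0.
  by rewrite lerXn2r ?nnegrE ?exprn_ge0.
- by rewrite expn0 expn_gt0.
by rewrite -ltn_monomialN; vm_compute.
Qed.

Lemma degree_bound4 : b = 2 -> n = m -> (m < 17)%N.
Proof.
move=> b2 Dn; pose s := a * (2 - a).
pose f (t : algR) := 4 * t * (1 - 4 * t).
have tb i : tau i b = 2 by rewrite b2 rmorph_nat.
have Dn' : n = (1 * m)%N by rewrite mul1n.
apply: (@scheme_bound algR n 1 4 0 m g 1 255 4 _ n_gt0 Dn' isT).
- apply: (@norm_scheme 128 (s * (1 - s)) 0 f).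
  + by rewrite tb; lra.
  + by rewrite /s !(rmorphM, rmorphXn, rmorphB, rmorph_nat, rmorph1) !(rpredM, rpredX,
    rpredB, rpred_nat, rpred1).
  + move=> i; rewrite /f /t_ /s !(rmorphM, rmorphXn, rmorphB, rmorph_nat, rmorph1) tb.
    by field.
  + by move=> t t0 t1; apply: quadratic_bound4.
  move=> t t0 t1; rewrite /f; split.
    have n1 : 4 * t != 0 by rewrite lt_eqF //; lra.
    have n2 : 1 - 4 * t != 0 by rewrite gt_eqF //; lra.
    exact: mulf_neq0.
  rewrite normrM ltr0_norm ?gtr0_norm; try lra.
  have -> : 1 * 255 ^+ 4 = 255 ^+ 2 * 255 ^+ 2 :> algR by ring.
  by apply: ler_pM; lra.
- by rewrite expn0 expn_gt0.
by rewrite -ltn_monomialN; vm_compute.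
Qed.

Lemma degree_bound5 : b ^+ 2 - 5 * b + 5 = 0 -> g = 5%N -> n = (2 * m)%N -> (m < 11)%N.
Proof.
move=> b5 g5 Dn; pose s := a * (b - a).
pose f (t : algR) := t * (5 * t - 1).
have tb i : tau i b ^+ 2 - 5 * tau i b + 5 = 0.
  by rewrite -(rmorph_nat (tau i) 5) -rmorphXn -rmorphM -rmorphB -rmorphD b5 rmorph0.
have b_ge := root5_ge (tb i0).
apply: (@scheme_bound algR n 2 4 2 m g 5 197 16 _ n_gt0 Dn isT).
- apply: (@norm_scheme 197 (s * ((4 - b) * s - 1)) 2 f).
  + by lra.
  + by rewrite /s !(rmorphM, rmorphXn, rmorphB, rmorph_nat, rmorph1) !(rpredM, rpredX,
    rpredB, rpred_nat, rpred1).
  + move=> i; have b0 : tau i b != 0 by apply/eqP => b0; have := tb i; rewrite b0; lra.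
    have e5 : 4 - tau i b = 5 / tau i b ^+ 2.
      apply: (mulIf (expf_neq0 2 b0)); rewrite divfK ?expf_neq0 //.
      have -> : (4 - tau i b) * tau i b ^+ 2 = 5 - (1 + tau i b) * (tau i b ^+ 2 - 5 * tau i
        b + 5) by ring.
      by rewrite tb mulr0 subr0.
    rewrite /f /t_ /s !(rmorphM, rmorphXn, rmorphB, rmorph_nat, rmorph1) e5.
    by field.
  + by move=> t t0 t1; apply: quadratic_bound5.
  move=> t t0 t1; rewrite /f; split.
    have n2 : 5 * t - 1 != 0 by rewrite lt_eqF //; lra.
    by rewrite mulf_neq0 // lt_eqF.
  rewrite normrM !ltr0_norm; try lra.
  have -> : 5 * 197 ^+ 4 = 197 ^+ 2 * (5 * 197 ^+ 2) :> algR by ring.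
  by apply: ler_pM; lra.
- by rewrite g5 -leq_expN; vm_compute.
by rewrite g5 -ltn_monomialN; vm_compute.
Qed.

Lemma degree_bound7 : b ^+ 3 - 7 * b ^+ 2 + 14 * b - 7 = 0 -> g = 7%N -> n = (3 * m)%N -> (m
  < 11)%N.
Proof.
move=> b7 g7 Dn; pose s := a * (b - a).
pose f (t : algR) := t ^+ 2 * (1 - 4 * t) * (7 * t - 1).
have tb i : tau i b ^+ 3 - 7 * tau i b ^+ 2 + 14 * tau i b - 7 = 0.
  have := congr1 (tau i) b7.
  rewrite rmorphB rmorphD rmorphB [tau i (7 * _)]rmorphM [tau i (14 * _)]rmorphM.
  by rewrite !rmorphXn !rmorph_nat rmorph0.
have b_ge := root7_ge b_gt0 (tb i0).
apply: (@scheme_bound algR n 3 8 6 m g 28 400 300 _ n_gt0 Dn isT).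
- apply: (@norm_scheme 400
    (s ^+ 2 * (b ^+ 2 - 4 * s) * ((2 * b ^+ 2 - 13 * b + 21) * s - 1)) 6
    f).
  + by lra.
  + by rewrite /s !(rmorphM, rmorphXn, rmorphB, rmorphD, rmorph_nat, rmorph1) !(rpredM,
    rpredX, rpredB, rpredD, rpred_nat, rpred1).
  + move=> i; have b0 : tau i b != 0 by apply/eqP => b0; have := tb i; rewrite b0; lra.
    have e7 : 2 * tau i b ^+ 2 - 13 * tau i b + 21 = 7 / tau i b ^+ 2.
      apply: (mulIf (expf_neq0 2 b0)); rewrite divfK ?expf_neq0 //.
      have -> : (2 * tau i b ^+ 2 - 13 * tau i b + 21) * tau i b ^+ 2 =
        7 + (2 * tau i b + 1) * (tau i b ^+ 3 - 7 * tau i b ^+ 2 + 14 * tau i b - 7) by ring.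
      by rewrite tb mulr0 addr0.
    rewrite /f /t_ /s !(rmorphM, rmorphXn, rmorphB, rmorphD, rmorph_nat, rmorph1) e7.
    by field.
  + by move=> t t0 t1; apply: quartic_bound7.
  move=> t t0 t1; rewrite /f; split.
    have n2 : 1 - 4 * t != 0 by rewrite gt_eqF //; lra.
    have n3 : 7 * t - 1 != 0 by rewrite lt_eqF //; lra.
    by rewrite mulf_neq0 // mulf_neq0 // expf_neq0 // lt_eqF.
  rewrite !normrM [`|1 - _|]gtr0_norm ?[`|7 * t - _|]ltr0_norm ?normrX ?ltr0_norm; try lra.
  have -> : 28 * 400 ^+ 8 = (400 ^+ 2) ^+ 2 * (4 * 400 ^+ 2) * (7 * 400 ^+ 2) :> algR by ring.
  have t2 : (- t) ^+ 2 <= (400 ^+ 2) ^+ 2 by rewrite lerXn2r ?nnegrE ?exprn_ge0 //; lra.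
  have t3 : 0 <= 1 - 4 * t by lra.
  have t4 : 1 - 4 * t <= 4 * 400 ^+ 2 by lra.
  have t5 : 0 <= - (7 * t - 1) by lra.
  have t6 : - (7 * t - 1) <= 7 * 400 ^+ 2 by lra.
  have t7 : 0 <= (- t) ^+ 2 by rewrite sqr_ge0.
  by apply: (ler_pM (mulr_ge0 t7 t3) t5 (ler_pM t7 t3 t2 t4) t6).
- by rewrite g7 -leq_expN; vm_compute.
by rewrite g7 -ltn_monomialN; vm_compute.
Qed.
End NormEstimates.

Lemma table_bound_mem d : table_bound d != 0%N -> (d, table_bound d) \in bound_table.
Proof.
rewrite /table_bound; have : {subset [seq x <- bound_table | x.1 == d] <= bound_table}.
  by move=> x; rewrite mem_filter => /andP[].
have : all (fun x => x.1 == d) [seq x <- bound_table | x.1 == d] by apply: filter_all.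
case: filter => [|[e k] s] //= /andP[/eqP-> _] sub _.
by apply: sub; rewrite mem_head.
Qed.

Lemma table_abs_degree d k : (d, k) \in bound_table -> (k * totient d <= 2 * abs_degree_bound
  d)%N.
Proof.
have /allP tab : all (fun x => x.2 * totient x.1 <= 2 * abs_degree_bound x.1)%N bound_table.
  by vm_compute.
by move/tab.
Qed.

Lemma not_excluded_dim d M C n m b0 : n = (m * M)%N -> degree_excluded d M C b0.+1 ->
  (5 ^ (5 * n) * C ^ 10 <= 5 ^ 5 * 2 ^ 82 * d ^ 20 * cyclotomic_at1 d ^ (10 * m))%N ->
  (m <= b0)%N.
Proof.
move=> -> excl le_m; rewrite leqNgt; apply/negP => lt_m.
have /andP[+ _] := degree_excluded_mono lt_m excl.
by rewrite ltnNge le_m.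
Qed.

Section SmallOrder.
Variable zeta : algC.

Let sum_pow d : (1 < d)%N -> d.-primitive_root zeta -> \sum_(i < d) zeta ^+ i = 0.
Proof.
move=> d_gt1 prim_z; have := subrX1 zeta d; rewrite prim_expr_order // subrr => /esym/eqP.
rewrite mulf_eq0 subr_eq0 => /orP[/eqP z1|/eqP//].
have := eq_prim_root_expr prim_z 1 0; rewrite z1 expr0 expr1 eqxx.
by rewrite mod0n modn_small.
Qed.

Let zeta_neq0 d : (0 < d)%N -> d.-primitive_root zeta -> zeta != 0.
Proof. by move=> d_gt0 /prim_root_eq0->; rewrite -lt0n. Qed.

Lemma two_sub_trace3 : 3.-primitive_root zeta -> two_sub_trace zeta = 3.
Proof.
move=> prim_z; have z0 := @zeta_neq0 3 isT prim_z; have := @sum_pow 3 isT prim_z.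
rewrite !big_ord_recl big_ord0 /= => z3; apply/eqP; rewrite -subr_eq0; apply/eqP.
transitivity (- zeta^-1 * (zeta ^+ 0 + (zeta ^+ 1 + (zeta ^+ 2 + 0))));
  last by rewrite z3 mulr0.
by rewrite /two_sub_trace; field.
Qed.

Lemma two_sub_trace4 : 4.-primitive_root zeta -> two_sub_trace zeta = 2.
Proof.
move=> prim_z; have z0 := @zeta_neq0 4 isT prim_z.
have : (zeta ^+ 2 - 1) * (zeta ^+ 2 + 1) = 0.
  by rewrite -subr_sqr_1 -exprM prim_expr_order // subrr.
move/eqP; rewrite mulf_eq0 subr_eq0 -(expr0 zeta) (eq_prim_root_expr prim_z) /= => /eqP z2.
apply/eqP; rewrite -subr_eq0; apply/eqP.
transitivity (- zeta^-1 * (zeta ^+ 2 + zeta ^+ 0)); last by rewrite z2 mulr0.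
by rewrite /two_sub_trace; field.
Qed.

Lemma two_sub_trace5 (b := two_sub_trace zeta) : 5.-primitive_root zeta -> b ^+ 2 - 5 * b + 5
  = 0.
Proof.
move=> prim_z; have z0 := @zeta_neq0 5 isT prim_z; have := @sum_pow 5 isT prim_z.
rewrite !big_ord_recl big_ord0 /= => z5.
transitivity (zeta ^- 2 * (zeta ^+ 0 + (zeta ^+ 1 + (zeta ^+ 2 + (zeta ^+ 3 + (zeta ^+ 4 +
  0))))));
  last by rewrite z5 mulr0.
by rewrite /b /two_sub_trace; field.
Qed.

Lemma two_sub_trace7 (b := two_sub_trace zeta) :
  7.-primitive_root zeta -> b ^+ 3 - 7 * b ^+ 2 + 14 * b - 7 = 0.
Proof.
move=> prim_z; have z0 := @zeta_neq0 7 isT prim_z; have := @sum_pow 7 isT prim_z.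
rewrite !big_ord_recl big_ord0 /= => z7.
transitivity (- zeta ^- 3 * (zeta ^+ 0 + (zeta ^+ 1 + (zeta ^+ 2 + (zeta ^+ 3 + (zeta ^+ 4 +
  (zeta ^+ 5 + (zeta ^+ 6 + 0)))))))); last by rewrite z7 mulr0.
by rewrite /b /two_sub_trace; field.
Qed.

End SmallOrder.

Lemma sine_bound_real (d C : nat) (x : algR) : (1 < d)%N -> small_sine_bound d C -> 0 <= x ->
    (cyclotomic_at1 d)%:R ^+ 2 <= (coprime_dist_prod d)%:R ^+ 2 * x ^+ totient d ->
  C%:R <= x * d%:R ^+ 2.
Proof.
move=> d_gt1 small x_ge0 le_x; have P_gt0 := coprime_dist_prod_gt0 d_gt1.
have phi_gt0 : (0 < totient d)%N by rewrite totient_gt0 ltnW.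
have P0 : 0 < (coprime_dist_prod d)%:R ^+ 2 :> algR by rewrite exprn_gt0 ?ltr0n.
rewrite -(@ler_pXn2r _ (totient d)) ?nnegrE ?ler0n ?mulr_ge0 ?exprn_ge0 //.
rewrite -(ler_pM2r P0) exprMn mulrAC [x ^+ _ * _]mulrC.
apply: le_trans (ler_wpM2r _ le_x); last by rewrite !exprn_ge0.
by rewrite -exprM -!natrX -!natrM ler_nat.
Qed.

Unset Implicit Arguments.

Theorem theorem4p5 (d : nat) (K : fieldExtType rat)
    (iota : {rmorphism K -> algC}) (c a : K) :
  (3 <= d)%N ->
  (* iota is the given inclusion of K into R *)
  (forall x : K, iota x \is Num.real) ->
  (* c = cos^2(pi/d), so F_d = Q(c) *)
  iota c = cospi d ^+ 2 ->
  (* K = F_d(alpha) *)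
  (<<<<1; c>>; a>>)%VS = fullv ->
  (* alpha is a totally real algebraic integer *)
  iota a \in Aint ->
  (forall sigma : {rmorphism K -> algC}, sigma a \is Num.real) ->
  4 < iota a < 16 ^+ 2 ->
  (* conditions at the real embeddings other than the identity inclusion;
     note 4 sin^2(pi/d) = 4 - 4 cos^2(pi/d) = 4 - 4 c *)
  (forall sigma : {rmorphism K -> algC},
      (forall x : K, sigma x \is Num.real) ->
      (exists x : K, sigma x != iota x) ->
      0 < sigma a < sigma (4 - 4 * c)) ->
  [/\ (<<1; a>>)%VS = fullv,
      exists2 b : nat, (d, b) \in bound_table & (\dim_(<<1; c>>%VS) (fullv : {vspace K}) <= b)%N
    & (\dim (fullv : {vspace K}) <= abs_degree_bound d)%N].
Proof.
move=> d_ge3 iota_real iota_c K_gen aA a_real /andP[a_gt4 a_lt] a_conj.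
have [K_a [tau [i0 [tau0 tau_conj norm_ge1 norm_b [dimK dimF]]]]] :=
  real_embeddings d_ge3 iota_c K_gen a_real a_gt4 a_conj.
have d_gt1 : (1 < d)%N by lia.
set m := \dim_(<<1; c>>) {:K} in norm_b dimK *;
  set n := \dim {:K} in tau i0 tau0 tau_conj norm_ge1 norm_b dimK *.
set b := 4 - 4 * c in tau_conj norm_b.
pose zeta : algC := d.-root (-1) ^+ 2;
  have prim_z : d.-primitive_root zeta := rootCN1_sqr_prim d_gt1.
have iota_b : iota b = two_sub_trace zeta.
  by rewrite /b rmorphB rmorphM !rmorph_nat iota_c four_sub_cospi.
have zA := Aint_prim_root prim_z.
have bA : iota b \in Aint.
  rewrite iota_b /two_sub_trace (prim_root_inv d_ge3 prim_z).
  by apply: rpredB; [apply: rpredB; [apply: rpred_nat|] | apply: rpredX].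
have z1 := norm_unity_root (ltnW d_gt1) (prim_expr_order prim_z).
have zeta1 : zeta != 1.
  apply: contraTneq prim_z => ->; apply/negP => prim_1.
  by have := eq_prim_root_expr prim_1 1 0; rewrite expr1 expr0 eqxx mod0n modn_small.
have b_gt0 : 0 < tau i0 b.
  suff : 0 < iota b by rewrite -tau0.
  by rewrite iota_b two_sub_trace_norm // exprn_gt0 // normr_gt0 subr_eq0 eq_sym.
have b_le4 : tau i0 b <= 4.
  suff : iota b <= 4 by rewrite -tau0.
  by rewrite iota_b; apply: (prim_root_trace_bounds prim_z d_ge3 (root_minCpoly _)).2.
have a0_gt4 : 4 < tau i0 a.
  by move: a_gt4; rewrite -tau0.
have a0_lt : tau i0 a < 256.
  have e : 16 ^+ 2 = val (256 : algR) by rewrite -natrX.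
  by move: a_lt; rewrite -tau0 e.
have n_gt0 : (0 < n)%N by rewrite /n adim_gt0.
have Dn : n = (m * (totient d)./2)%N.
  by apply/eqP; rewrite -(eqn_pmul2l (isT : 0 < 2)%N) dimK -dimF mul2n doubleK mulnCA -mul2n.
have m_gt0 : (0 < m)%N by move: n_gt0; rewrite Dn muln_gt0 => /andP[].
suffices le_m : (m <= table_bound d)%N.
  have tab : (d, table_bound d) \in bound_table
    by rewrite table_bound_mem // -lt0n (leq_trans m_gt0).
  split=> //; first by exists (table_bound d).
  rewrite -/n -(leq_pmul2l (isT : 0 < 2)%N) dimK.
  by apply: leq_trans (table_abs_degree tab); rewrite leq_mul2r le_m orbT.
have [special|not_special] := boolP (d \in [:: 3; 4; 5; 7]%N).
  have iota_inj := fmorph_inj iota.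
  move: special; rewrite !inE => /or4P[] /eqP Dd; rewrite Dd in prim_z Dn norm_b *.
  - have b3 : b = 3 by apply: iota_inj; rewrite iota_b two_sub_trace3 ?rmorph_nat.
    rewrite (_ : table_bound 3 = 47%N) // -ltnS.
    apply: (degree_bound3 tau_conj norm_ge1 norm_b aA a0_gt4 a0_lt b_gt0 b_le4 b3).
    by rewrite [LHS]Dn muln1.
  - have b2 : b = 2 by apply: iota_inj; rewrite iota_b two_sub_trace4 ?rmorph_nat.
    rewrite (_ : table_bound 4 = 16%N) // -ltnS.
    apply: (degree_bound4 tau_conj norm_ge1 norm_b aA a0_gt4 a0_lt b_gt0 b_le4 b2).
    by rewrite [LHS]Dn muln1.
  - have b5 : b ^+ 2 - 5 * b + 5 = 0.
      apply: iota_inj; rewrite rmorphD rmorphB [iota (5 * b)]rmorphM rmorphXn !rmorph_nat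
        rmorph0.
      by rewrite iota_b; apply: two_sub_trace5.
    rewrite (_ : table_bound 5 = 10%N) // -ltnS.
    apply: (degree_bound5 tau_conj norm_ge1 norm_b aA bA a0_gt4 a0_lt b_gt0 b_le4 b5) => //.
    by rewrite [LHS]Dn mulnC.
  have b7 : b ^+ 3 - 7 * b ^+ 2 + 14 * b - 7 = 0.
    apply: iota_inj; rewrite rmorphB rmorphD rmorphB [iota (7 * _)]rmorphM [iota (14 *
      _)]rmorphM.
    by rewrite !rmorphXn !rmorph_nat rmorph0 iota_b; apply: two_sub_trace7.
  rewrite (_ : table_bound 7 = 10%N) // -ltnS.
  apply: (degree_bound7 tau_conj norm_ge1 norm_b aA bA a0_gt4 a0_lt b_gt0 b_le4 b7) => //.
  by rewrite [LHS]Dn mulnC.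
have phi_even : ~~ odd (totient d) by rewrite -dimF oddM.
have [C [C_gt0 small excl]] := not_special_dim_bound d_ge3 not_special phi_even.
have le_b : C%:R <= tau i0 b * d%:R ^+ 2.
  apply: sine_bound_real (ltW b_gt0) _ => //.
  have := two_sub_trace_lower_bound d_gt1 prim_z; rewrite -iota_b -tau0 => le_x.
  have e k j : val (k%:R ^+ j : algR) = k%:R ^+ j
    by rewrite (rmorphXn algRval) (rmorph_nat algRval).
  have e' k x j l : val (k%:R ^+ j * x ^+ l : algR) = k%:R ^+ j * val x ^+ l.
    by rewrite (rmorphM algRval) /= e (rmorphXn algRval).
  suff : val ((cyclotomic_at1 d)%:R ^+ 2 : algR) <=
         val ((coprime_dist_prod d)%:R ^+ 2 * tau i0 b ^+ totient d) by [].
  by rewrite e e'.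
apply: not_excluded_dim Dn excl _.
exact: (general_norm_bound tau_conj norm_ge1 norm_b aA bA a0_gt4 a0_lt b_gt0 b_le4 C_gt0
  (ltnW d_gt1) le_b).
Qed.
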